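(* Let $d\ge 3$ and $V$ real-valued. Let $m\in\{1,\dots,Q\}$ and let $\lambda_*$ be an extremum of $\lambda_m$ over $[0,1)^d$ (i.e. $\lambda_*=\max_{k\in[0,1)^d}\lambda_m(k)$ or $\lambda_*=\min_{k\in[0,1)^d}\lambda_m(k)$). Then the set $\{k\in[0,1)^d:\lambda_m(k)=\lambda_*\}$ has (real) dimension at most $d-2$.
   Context: Fix positive integers $q_1,\dots,q_d$ with greatest common divisor $1$, $Q=q_1\cdots q_d$, $\Gamma=q_1\mathbb{Z}\oplus\cdots\oplus q_d\mathbb{Z}$, and a $\Gamma$-periodic $V:\mathbb{Z}^d\to\mathbb{R}$. The discrete Laplacian is $(\Delta u)(n)=\sum_{\|n'-n\|_1=1}u(n')$. For $k\in\mathbb{R}^d$, $D(k)$ is the $Q\times Q$ Hermitian matrix of $-\Delta+V$ on the space of $u:\mathbb{Z}^d\to\mathbb{C}$ with $u(n+q_je_j)=e^{2\pi ik_j}u(n)$ for all $j,n$ (identified with functions on $W=\{n:0\le n_j\le q_j-1\}$). Its eigenvalues in non-decreasing order are $\lambda_1(k)\le\cdots\le\lambda_Q(k)$; $\lambda_m$ is the $m$-th band function. The level set is a real semi-analytic subset of $\mathbb{R}^d$ and dimension refers to its dimension as such. *)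

(* Defs.v *)
From HB Require Import structures.
From mathcomp Require Import all_boot all_order all_algebra.
From mathcomp Require Import all_classical all_reals all_analysis.
From mathcomp Require Import complex.
Set Implicit Arguments. Unset Strict Implicit. Unset Printing Implicit Defensive.
Import Order.TTheory GRing.Theory Num.Theory.
Import numFieldNormedType.Exports.
Local Open Scope classical_set_scope.
Local Open Scope ring_scope.
Local Open Scope complex_scope.

Definition cell (d : nat) (q : 'I_d -> nat) : finType :=
  {dffun forall j : 'I_d, 'I_(q j)}.

Definition lattice (d : nat) := 'I_d -> int.

Definition embed_cell d (q : 'I_d -> nat) (n : cell q) : lattice d :=
  fun j => (nat_of_ord (n j))%:Z.

Definition Gamma_periodic (R : realType) d (q : 'I_d -> nat)
  (V : lattice d -> R) : Prop :=
  forall (n : lattice d) (j : 'I_d),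
    V (fun i => if i == j then n i + (q j)%:Z else n i) = V n.

Definition cexp2pi (R : realType) (t : R) : R[i] :=
  Complex (cos (2 * pi * t)) (sin (2 * pi * t)).

(* Coefficient of the basis function at n' in the value of u at the neighbour
   n + s e_j (s = +1 if b, -1 otherwise) of n in W, for u satisfying the
   Floquet-Bloch condition u(n + q_j e_j) = e^{2 pi i k_j} u(n). *)
Definition nbr_coef (R : realType) d (q : 'I_d -> nat) (k : 'rV[R]_d)
  (n n' : cell q) (j : 'I_d) (b : bool) : R[i] :=
  let c : int := (nat_of_ord (n j))%:Z + (if b then 1 else -1) in
  let wrapped : int := if c == (q j)%:Z then 0
                       else if c == -1 then (q j)%:Z - 1 else c in
  let phase : R[i] := if c == (q j)%:Z then cexp2pi (k 0 j)
                      else if c == -1 then cexp2pi (- k 0 j) else 1 in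
  if [forall i, (nat_of_ord (n' i))%:Z ==
                (if i == j then wrapped else (nat_of_ord (n i))%:Z)]
  then phase else 0.

(* The Q x Q Hermitian matrix D(k) of -Delta + V on the Floquet-Bloch space,
   indexed by W (through the enumeration of the finite type W). *)
Definition Dmat (R : realType) d (q : 'I_d -> nat) (V : lattice d -> R)
  (k : 'rV[R]_d) : 'M[R[i]]_(#|cell q|) :=
  \matrix_(a, b)
    let n := enum_val a in let n' := enum_val b in
    ((if n == n' then (V (embed_cell n))%:C else 0)
     - \sum_(j < d) (nbr_coef k n n' j true + nbr_coef k n n' j false)).

Definition eigen_spec (R : realType) d (q : 'I_d -> nat) (V : lattice d -> R)
  (k : 'rV[R]_d) (s : seq R) : Prop :=
  sorted <=%R s /\
  char_poly (Dmat q V k) = \prod_(x <- s) ('X - (x%:C)%:P).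

Definition band (R : realType) d (q : 'I_d -> nat) (V : lattice d -> R)
  (m : nat) (k : 'rV[R]_d) : R :=
  nth 0 (xget [::] (eigen_spec q V k)) m.-1.

Definition unit_box (R : realType) d : set 'rV[R]_d :=
  [set k | forall j : 'I_d, 0 <= k 0 j < 1].

Definition has_C1_patch (R : realType) d (p : nat) (A : set 'rV[R]_d) : Prop :=
  exists (U : set 'rV[R]_p) (phi : 'rV[R]_p -> 'rV[R]_d),
    [/\ open U, U !=set0, phi @` U `<=` A,
        (forall x, U x -> differentiable phi x /\ injective ('d phi x)) &
        (forall (v : 'rV[R]_p) x, U x ->
           {for x, continuous (fun y => 'D_v phi y)})].

(* dim A <= n (dimension of a semi-analytic set = maximal dimension of a
   C^1 submanifold contained in it). *)
Definition dim_le (R : realType) d (n : nat) (A : set 'rV[R]_d) : Prop :=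
  forall p : nat, (n < p)%N -> ~ has_C1_patch p A.
Arguments unit_box : clear implicits.

(* Main.v *)
Require Import Defs.
From HB Require Import structures.
From mathcomp Require Import all_boot all_order all_algebra.
From mathcomp Require Import all_classical all_reals all_analysis.
From mathcomp Require Import complex.
From mathcomp Require Import perm spectral sesquilinear separable cyclotomic ring lra zify.
Import Order.TTheory GRing.Theory Num.Theory.
Import numFieldNormedType.Exports.
Local Open Scope classical_set_scope.
Local Open Scope ring_scope.

(* Up to conjugation by [prod_i w_i ^ n_i], where [w_i = exp (2 pi i k_i / q_i)],
   the matrix [D(k)] is a combination of cyclic shifts with coefficients [w_i] and
   [1 / w_i].  Hence for fixed [j] the function [x ^ Q det (D - lam)] is a
   polynomial of degree [2 Q] in the single variable [x = w_j], whose coefficients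
   are Laurent polynomials in the other [w_i].

   At a point of the level set of an extremum this polynomial has a double root:
   by Weyl's inequality the eigenvalues move by [O(|z - 1|)] when [w_j] is replaced
   by [w_j z], so either two of them touch [lam], or the product of all
   [lambda_l - lam] does not change sign; a simple root would make it change sign
   to first order.

   If the level set contained a C^1 patch of dimension at least [d - 1], then for
   some [j] the coordinates [k_i], [i <> j], would have independent differentials on
   an open part of it.  The discriminant in [x] is a Laurent polynomial in the [w_i],
   [i <> j], that vanishes on this part together with all its derivatives, hence it
   vanishes identically.

   However, for [w_i = c_i / e] with [e] small and [c] generic, the [2 Q] roots are
   close to [r / e] and [e / r], where [r] runs over the [Q] numbers
   [- sum_(i <> j) c_i rho_i / rho_j] attached to the characters [rho] of
   [prod_i Z/q_i].  They are distinct because two characters proportional to each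
   other differ by a scalar [z] with [z ^ q_i = 1] for all [i], and the gcd is [1].
   So the polynomial is separable there and its discriminant is nonzero. *)

(** * Weyl's inequality *)

Section Weyl.
Variable C : numClosedFieldType.
Local Notation "M ^t*" := (map_mx Num.conj (trmx M)) (at level 30).

Lemma trmxC_mul m n p (A : 'M[C]_(m, n)) (B : 'M[C]_(n, p)) :
  (A *m B) ^t* = B ^t* *m A ^t*.
Proof. by rewrite trmx_mul map_mxM. Qed.

(** The rows of [U] are orthonormal left eigenvectors, so on combinations of selected rows the form
    is diagonal, weighted by the selected eigenvalues. *)
Lemma eigen_rows_form m n (f : 'I_m -> 'I_n) (U : 'M[C]_n) (a : 'rV[C]_n) (y : 'rV[C]_m) :
  injective f -> U \is unitarymx ->
  let x := y *m rowsub f U in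
  (x *m (invmx U *m diag_mx a *m U) *m x ^t*) 0 0 = \sum_i a 0 (f i) * `|y 0 i| ^+ 2.
Proof.
move=> f_inj Uu x; rewrite /x; have Uunit := unitarymx_unit Uu.
have -> : rowsub f U = rowsub f 1%:M *m U by rewrite mul_rowsub_mx mul1mx.
rewrite trmxC_mul trmxC_mul -(invmx_unitary Uu); set G := rowsub f 1%:M.
have -> : y *m (G *m U) *m (invmx U *m diag_mx a *m U) *m (invmx U *m G ^t* *m y ^t*) =
    y *m (G *m (diag_mx a *m G ^t*)) *m y ^t*.
  by rewrite !mulmxA mulmxK // mulmxK.
rewrite {}/G.
have -> : rowsub f 1%:M *m (diag_mx a *m rowsub f 1%:M ^t*) = diag_mx (\row_i a 0 (f i)).
  apply/matrixP => i j; rewrite mul_rowsub_mx mul1mx !mxE (bigD1 (f i)) //= big1 => [|k ki].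
    by rewrite !mxE eqxx mulr1n (inj_eq f_inj) eq_sym addr0; case: eqP => // _; rewrite ?rmorph1 ?mulr1 ?rmorph0 ?mulr0.
  by rewrite !mxE eq_sym (negbTE ki) mul0r.
rewrite mul_mx_diag mxE; apply: eq_bigr => i _.
by rewrite !mxE normCK mulrAC mulrC.
Qed.

(** Dimension count: were the sum larger than [n], the span of the eigenvectors of [A] with
    eigenvalue at most [c] would meet the span of those of [B] with eigenvalue above [c + e]. On a
    common nonzero vector the two forms differ by more than [e] times its squared norm. *)
Lemma weyl_count n (A B U W : 'M[C]_n) (a b : 'rV[C]_n) (c e : C) :
  A = invmx U *m diag_mx a *m U -> B = invmx W *m diag_mx b *m W ->
  U \is unitarymx -> W \is unitarymx ->
  (forall i, a 0 i \is Num.real) -> (forall i, b 0 i \is Num.real) ->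
  (forall x : 'rV[C]_n,
    `|(x *m (B - A) *m x ^t*) 0 0|
      <= e * (x *m x ^t*) 0 0) ->
  (#|[pred i | (a 0 i <= c)%R]| + #|[pred i | (c + e < b 0 i)%R]| <= n)%N.
Proof.
move=> EA EB Uu Wu ar br H; set I := [pred i | a 0 i <= c]; set J := [pred i | c + e < b 0 i].
pose E := rowsub (@enum_val _ I) U; pose F := rowsub (@enum_val _ J) W.
have rk (K : pred 'I_n) (M : 'M[C]_n) : M \is unitarymx -> \rank (rowsub (@enum_val _ K) M) = #|K|.
  move=> Mu; rewrite mxrank_unitary //; apply/unitarymxP.
  have -> : rowsub (@enum_val _ K) M = rowsub (@enum_val _ K) 1%:M *m M.
    by rewrite mul_rowsub_mx mul1mx.
  rewrite trmxC_mul -(invmx_unitary Mu) mulmxA mulmxK ?unitarymx_unit //.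
  apply/matrixP => i j; rewrite mul_rowsub_mx mul1mx !mxE.
  by rewrite (inj_eq enum_val_inj) eq_sym; case: eqP; rewrite ?rmorph1 ?rmorph0.
rewrite leqNgt; apply/negP => lt.
have : (0 < \rank (E :&: F))%N.
  have rE : \rank E = #|I| := rk I U Uu.
  have rF : \rank F = #|J| := rk J W Wu.
  have := mxrank_sum_cap E F; rewrite rE rF => eq1.
  rewrite -(ltn_add2l (\rank (E + F)%MS)) addn0 eq1; apply: leq_ltn_trans lt.
  exact: rank_leq_col.
rewrite lt0n mxrank_eq0 -nz_row_eq0 => xn0.
set x := nz_row _ in xn0.
have /submxP[y xy] : (x <= E)%MS by rewrite (submx_trans (nz_row_sub _)) ?capmxSl.
have /submxP[z xz] : (x <= F)%MS by rewrite (submx_trans (nz_row_sub _)) ?capmxSr.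
(* Parseval, read off from the diagonal form with all eigenvalues equal to 1. *)
have nE m (M : 'M[C]_n) (f : 'I_m -> 'I_n) (u : 'rV[C]_m) : injective f -> M \is unitarymx ->
    x = u *m rowsub f M -> (x *m x ^t*) 0 0 = \sum_i `|u 0 i| ^+ 2.
  move=> finj Mu xE; have /= := eigen_rows_form _ _ f M (const_mx 1) u finj Mu.
  rewrite -xE diag_const_mx mulmx1 mulVmx ?unitarymx_unit // mulmx1 => ->.
  by apply: eq_bigr => i _; rewrite mxE mul1r.
have := H x; rewrite mulmxBr mulmxBl mxE.
have /= := eigen_rows_form _ _ _ W b z (@enum_val_inj _ J) Wu; rewrite -/F -xz -EB => ->.
have /= := eigen_rows_form _ _ _ U a y (@enum_val_inj _ I) Uu; rewrite -/E -xy -EA => Ea.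
rewrite [X in _ + X]mxE Ea.
have x0 : (x *m x ^t*) 0 0 != 0.
  by rewrite -dotmxE dnorm_eq0.
set N := (x *m x ^t*) 0 0 in x0 *.
have Nz : N = \sum_i `|z 0 i| ^+ 2 := nE _ _ _ _ (@enum_val_inj _ J) Wu xz.
have Ny : N = \sum_i `|y 0 i| ^+ 2 := nE _ _ _ _ (@enum_val_inj _ I) Uu xy.
(* Strictness comes from one nonzero coordinate of [z], which exists because [x] is nonzero. *)
have rlt : (c + e) * N < \sum_i b 0 (enum_val i) * `|z 0 i| ^+ 2.
  rewrite Nz mulr_sumr; have [i zi0] : exists i, z 0 i != 0.
    apply/existsP; rewrite -negb_forall; apply: contraNN xn0 => /forallP z0.
    have -> : x = 0 by rewrite xz (_ : z = 0) ?mul0mx //; apply/rowP => i; rewrite mxE; apply/eqP.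
    by [].
  have bi j : c + e < b 0 (enum_val (A := J) j) by have := enum_valP j.
  rewrite (bigD1 i) //= [X in _ < X](bigD1 i) //= ltr_leD //.
    by rewrite ltr_pM2r // exprn_gt0 // normr_gt0.
  by apply: ler_sum => j _; rewrite ler_wpM2r ?exprn_ge0 // ltW.
have lel : \sum_i a 0 (enum_val i) * `|y 0 i| ^+ 2 <= c * N.
  rewrite Ny mulr_sumr; apply: ler_sum => j _; rewrite ler_wpM2r ?exprn_ge0 //.
  by have := enum_valP j.
have sr m (f : 'I_m -> 'I_n) (g : 'rV[C]_n) (u : 'rV[C]_m) : (forall i, g 0 i \is Num.real) ->
    \sum_i g 0 (f i) * `|u 0 i| ^+ 2 \is Num.real.
  by move=> aR; apply: rpred_sum => i _; rewrite rpredM // ?rpredX // normr_real.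
move=> le1; have := le_trans (real_ler_norm _) le1.
rewrite rpredB ?sr // => /(_ isT) le2.
have lt3 := ltr_leB rlt lel.
by have := lt_le_trans lt3 le2; rewrite mulrDl [c * N + _]addrC addrK ltxx.
Qed.

Lemma form_entry_bound n (A : 'M[C]_n) (e : C) (x : 'rV[C]_n) :
  (forall i j, `|A i j| <= e) ->
  `|(x *m A *m x ^t*) 0 0| <= n%:R * e * (x *m x ^t*) 0 0.
Proof.
move=> He; have -> : (x *m x ^t*) 0 0 = \sum_i `|x 0 i| ^+ 2.
  by rewrite mxE; apply: eq_bigr => i _; rewrite !mxE normCK.
rewrite -mulmxA mxE.
(* The bound is spread over all pairs [(i, j)], so that the arithmetic-geometric mean inequality can
   be applied entry by entry. *)
have -> : n%:R * e * (\sum_i `|x 0 i| ^+ 2) =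
    \sum_i \sum_j e * ((`|x 0 i| ^+ 2 + `|x 0 j| ^+ 2) / 2).
  set S := \sum_i `|x 0 i| ^+ 2; have E i : \sum_j e * ((`|x 0 i| ^+ 2 + `|x 0 j| ^+ 2) / 2) =
      e / 2 * (n%:R * `|x 0 i| ^+ 2 + S).
    rewrite -mulr_sumr -mulr_suml big_split sumr_const card_ord /= -/S.
    by rewrite -[_ *+ n]mulr_natl mulrA mulrAC.
  rewrite (eq_bigr _ (fun i _ => E i)) -mulr_sumr big_split sumr_const card_ord /= -mulr_sumr -/S.
  by rewrite -[_ *+ n]mulr_natl; clear E; clearbody S; field.
apply: le_trans (ler_norm_sum _ _ _) _; apply: ler_sum => i _.
rewrite normrM mxE; apply: le_trans (ler_wpM2l (normr_ge0 _) (ler_norm_sum _ _ _)) _.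
rewrite mulr_sumr; apply: ler_sum => j _; rewrite normrM !mxE norm_conjC mulrCA.
apply: ler_pM; [exact: normr_ge0|exact: mulr_ge0|exact: He|].
rewrite ler_pdivlMr // -subr_ge0.
have -> : `|x 0 i| ^+ 2 + `|x 0 j| ^+ 2 - `|x 0 i| * `|x 0 j| * 2 = (`|x 0 i| - `|x 0 j|) ^+ 2 by ring.
by rewrite real_exprn_even_ge0 // rpredB // normr_real.
Qed.
End Weyl.

(** * Ordered real spectra of Hermitian matrices and Weyl's bound for them *)

Section SortedSpectrum.
Variable R : rcfType.
Local Notation "M ^t*" := (map_mx Num.conj (trmx M)) (at level 30).
Local Open Scope complex_scope.

Lemma herm_diag n (A : 'M[R[i]]_n) : A ^t* = A ->
  exists U : 'M[R[i]]_n, exists a : 'I_n -> R,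
    U \is unitarymx /\ A = invmx U *m diag_mx (\row_i (a i)%:C) *m U.
Proof.
move=> hA; have hs : A \is hermsymmx by apply/is_hermitianmxP; rewrite expr0 scale1r hA.
have /mxOverP rd := hermitian_spectral_diag_real hs.
exists (spectralmx A), (fun i => complex.Re (spectral_diag A 0 i)); split; first exact: spectral_unitarymx.
have -> : \row_i (complex.Re (spectral_diag A 0 i))%:C = spectral_diag A.
  by apply/rowP => i; rewrite mxE RRe_real.
exact: (elimT (@orthomx_spectralP _ _ A) (hermitian_normalmx hs)).
Qed.

Lemma char_poly_diag n (U : 'M[R[i]]_n) (a : 'I_n -> R) : U \in unitmx ->
  char_poly (invmx U *m diag_mx (\row_i (a i)%:C) *m U) =
  \prod_(x <- codom a) ('X - (x%:C)%:P).
Proof.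
move=> Uu; rewrite /char_poly /char_poly_mx.
have Uu' : map_mx polyC U \in unitmx by rewrite map_unitmx.
have -> : 'X%:M - map_mx polyC (invmx U *m diag_mx (\row_i (a i)%:C) *m U) =
   invmx (map_mx polyC U) *m ('X%:M - map_mx polyC (diag_mx (\row_i (a i)%:C))) *m map_mx polyC U.
  rewrite !map_mxM map_invmx mulmxBr mulmxBl; congr (_ - _).
  by rewrite scalar_mxC -mulmxA mulVmx // mulmx1.
rewrite !det_mulmx mulrAC -det_mulmx mulVmx // det1 mul1r -/(char_poly_mx _) -/(char_poly _).
rewrite char_poly_trig ?diag_mx_is_trig // big_map enumT.
by apply: eq_bigr => i _; rewrite !mxE eqxx mulr1n.
Qed.

Lemma char_poly_uniq (s t : seq R) :
  \prod_(x <- s) ('X - (x%:C)%:P) = \prod_(x <- t) ('X - (x%:C)%:P) :> {poly R[i]} ->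
  perm_eq s t.
Proof.
move=> H; apply: (perm_map_inj (@complexI R)); apply: prod_XsubC_eq.
by rewrite !big_map.
Qed.

Lemma herm_sorted_spectrum n (A : 'M[R[i]]_n) : A ^t* = A ->
  exists s : seq R, sorted <=%R s /\ char_poly A = \prod_(x <- s) ('X - (x%:C)%:P).
Proof.
move=> /herm_diag [U [a [Uu ->]]]; exists (sort <=%R (codom a)); split.
  exact/sort_sorted/le_total.
rewrite char_poly_diag ?unitarymx_unit //; apply: perm_big.
by rewrite perm_sym perm_sort.
Qed.

Lemma size_spectrum n (A : 'M[R[i]]_n) (s : seq R) :
  char_poly A = \prod_(x <- s) ('X - (x%:C)%:P) -> size s = n.
Proof.
by move=> /(congr1 (size \o val)) /=; rewrite size_char_poly -(big_map _ xpredT (fun x => 'X - x%:P)) size_prod_XsubC size_map => -[].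
Qed.

Lemma sorted_count_le (s : seq R) l c : sorted <=%R s -> (l < size s)%N ->
  nth 0 s l <= c -> (l < count (fun x => (x <= c)%R) s)%N.
Proof.
move=> so ls lc; rewrite -(cat_take_drop l.+1 s) count_cat.
apply: leq_trans (leq_addr _ _); rewrite -[X in (X <= _)%N](size_takel ls).
rewrite (_ : size _ = count (fun x => x <= c) (take l.+1 s)) //; apply/esym/eqP; rewrite -all_count.
apply/(all_nthP 0) => i; rewrite size_takel // => il; rewrite nth_take //.
by apply: le_trans lc; rewrite le_sorted_leq_nth // inE (@leq_ltn_trans l i _ il ls).
Qed.

Lemma sorted_count_gt (s : seq R) l c : sorted <=%R s -> (l < size s)%N ->
  c < nth 0 s l -> (size s - l <= count (fun x => (c < x)%R) s)%N.
Proof.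
move=> so ls lc; rewrite -{2}(cat_take_drop l s) count_cat.
apply: leq_trans (leq_addl _ _); rewrite -size_drop.
rewrite (_ : size _ = count (fun x => c < x) (drop l s)) //; apply/esym/eqP; rewrite -all_count.
apply/(all_nthP 0) => i; rewrite size_drop => il; rewrite nth_drop.
apply: lt_le_trans lc _; rewrite le_sorted_leq_nth // ?inE ?leq_addr //.
by rewrite -ltn_subRL.
Qed.

(** If the bound failed at index [l], at least [l + 1] eigenvalues of [A] would be at most
    [nth 0 s l] and at least [n - l] eigenvalues of [B] would exceed it by more than [n e]: one too
    many for [weyl_count]. The reverse bound follows by exchanging [A] and [B]. *)
Lemma weyl_le n (A B : 'M[R[i]]_n) (s t : seq R) (e : R) :
  A ^t* = A -> B ^t* = B ->
  sorted <=%R s -> char_poly A = \prod_(x <- s) ('X - (x%:C)%:P) ->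
  sorted <=%R t -> char_poly B = \prod_(x <- t) ('X - (x%:C)%:P) ->
  (forall i j, `|(B - A) i j| <= e%:C) ->
  forall l, (l < n)%N -> nth 0 t l <= nth 0 s l + n%:R * e.
Proof.
move=> hA hB so sA to tB He l ln; rewrite leNgt; apply/negP => lt.
have [U [a [Uu EA]]] := herm_diag _ _ hA; have [W [b [Wu EB]]] := herm_diag _ _ hB.
have sa : perm_eq s (codom a).
  by have := char_poly_diag _ U a (unitarymx_unit Uu); rewrite -EA sA; apply: char_poly_uniq.
have tb : perm_eq t (codom b).
  by have := char_poly_diag _ W b (unitarymx_unit Wu); rewrite -EB tB; apply: char_poly_uniq.
have ar i : (\row_i (a i)%:C) 0 i \is Num.real by rewrite mxE; apply/complex_realP; exists (a i).
have br i : (\row_i (b i)%:C) 0 i \is Num.real by rewrite mxE; apply/complex_realP; exists (b i).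
have := (@weyl_count _ n A B U W (\row_i (a i)%:C) (\row_i (b i)%:C) (nth 0 s l)%:C (n%:R * e)%:C EA EB Uu Wu ar br).
suff Hc : ~ (#|[pred i | ((\row_i (a i)%:C) 0 i <= (nth 0 s l)%:C)%R]| + #|[pred i | ((nth 0 s l)%:C + (n%:R * e)%:C < (\row_i (b i)%:C) 0 i)%R]| <= n)%N.
  move=> /(_ _) H; apply/Hc/H => x.
  by have := form_entry_bound _ _ _ _ x He; rewrite rmorphM /= rmorph_nat.
apply/negP; rewrite -ltnNge.
have cnt (f : 'I_n -> R) (P : pred R) u : perm_eq u (codom f) -> #|[pred i | P (f i)]| = count P u.
  move=> /seq.permP ->; rewrite cardE /enum_mem size_filter codomE count_map enumT.
  by apply: eq_count => i.
have -> : #|[pred i | ((\row_i (a i)%:C) 0 i <= (nth 0 s l)%:C)%R]| = count (fun x => (x <= nth 0 s l)%R) s.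
  by rewrite -(cnt a) //; apply: eq_card => i; rewrite !inE mxE lecR.
have -> : #|[pred i | ((nth 0 s l)%:C + (n%:R * e)%:C < (\row_i (b i)%:C) 0 i)%R]| =
    count (fun x => (nth 0 s l + n%:R * e < x)%R) t.
  by rewrite -(cnt b) //; apply: eq_card => i; rewrite !inE mxE -rmorphD /= ltcR.
have ls : (l < size s)%N by rewrite (size_spectrum _ _ _ sA).
have lt' : (l < size t)%N by rewrite (size_spectrum _ _ _ tB).
have := sorted_count_le s l (nth 0 s l) so ls (lexx _).
have := sorted_count_gt t l _ to lt' lt; rewrite (size_spectrum _ _ _ tB).
move: (count _ t) (count _ s) => c1 c2; lia.
Qed.

End SortedSpectrum.

(** * Double roots at extremal eigenvalues *)

Lemma poly_lipschitz_root (C : numClosedFieldType) (q : {poly C}) (a : C) :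
  q.[a] = 0 -> exists2 K : C, 0 <= K &
    forall x, `|x - a| <= 1 -> `|q.[x]| <= K * `|x - a|.
Proof.
move=> /eqP/factor_theorem[q1 ->].
exists (\sum_(i < size q1) `|q1`_i| * (`|a| + 1) ^+ i) => [|x xa].
  by apply: sumr_ge0 => i _; rewrite mulr_ge0 ?exprn_ge0 ?addr_ge0.
rewrite hornerM hornerXsubC normrM ler_wpM2r // horner_coef.
apply: le_trans (ler_norm_sum _ _ _) _; apply: ler_sum => i _.
rewrite normrM normrX ler_wpM2l // lerXn2r ?nnegrE ?addr_ge0 //.
by rewrite -{1}[x](subrK a) (le_trans (ler_normD _ _)) // addrC lerD2l.
Qed.

(* Near an extremal eigenvalue each pair of factors is nonnegative, unless the
   eigenvalue is multiple, in which case two pairs are of size [d ^+ 2]. *)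
Lemma extremal_prod_ge (R : realFieldType) N (m : 'I_N) (s0 : 'I_N -> R) (lam K : R) :
  0 <= K -> s0 m = lam ->
  exists C d0 : R, [/\ 0 <= C, 0 < d0 & forall (s t : 'I_N -> R) (d : R),
    0 <= d -> d < d0 -> (forall l, `|s l - s0 l| <= K * d) -> (forall l, `|t l - s0 l| <= K * d) ->
    0 <= (s m - lam) * (t m - lam) ->
    - (C * d ^+ 4) <= (\prod_l (s l - lam)) * (\prod_l (t l - lam))].
Proof.
move=> K0 s0m; case: (boolP [exists l, (l != m) && (s0 l == lam)]).
- move=> /existsP[l /andP[lm /eqP s0l]].
  (* The pairs at [m] and [l] are each at most [(K d)^2]; every other pair is bounded using
     [d < 1]. *)
  exists (K ^+ 4 * \prod_(i | (i != m) && (i != l)) (`|s0 i - lam| + K) ^+ 2), 1; split=> //.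
    by rewrite mulr_ge0 ?exprn_ge0 // prodr_ge0 // => i _; rewrite exprn_ge0 // addr_ge0.
  move=> s t d d_ge0 d1 hs ht _; rewrite -big_split /=.
  suff : `|\prod_i ((s i - lam) * (t i - lam))| <=
     K ^+ 4 * \prod_(i | (i != m) && (i != l)) (`|s0 i - lam| + K) ^+ 2 * d ^+ 4.
    by rewrite ler_norml => /andP[].
  have h2 i : s0 i = lam -> `|(s i - lam) * (t i - lam)| <= (K * d) ^+ 2.
    by move=> <-; rewrite normrM expr2 ler_pM.
  rewrite normr_prod (bigD1 m) //= (bigD1 l) //=.
  set B := \prod_(i | _) _ ^+ 2.
  have -> : K ^+ 4 * B * d ^+ 4 = (K * d) ^+ 2 * ((K * d) ^+ 2 * B) by ring.
  rewrite ler_pM ?h2 ?mulr_ge0 ?prodr_ge0 // ler_pM ?h2 ?prodr_ge0 //.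
  apply: ler_prod => i _; rewrite normr_ge0 /= normrM expr2.
  have hh (u : R) : `|u - s0 i| <= K * d -> `|u - lam| <= `|s0 i - lam| + K.
    move=> hu; have -> : u - lam = (s0 i - lam) + (u - s0 i) by ring.
    apply: le_trans (ler_normD _ _) _; rewrite lerD2l (le_trans hu) //.
    by rewrite ler_piMr // ltW.
  by rewrite ler_pM // hh.
move=> /existsPn ne.
have sep l : l != m -> 0 < `|s0 l - lam|.
  by move=> lm; have := ne l; rewrite lm /= normr_gt0 subr_eq0.
(* A product of numbers in [(0, 1]] lies below each of them, so this one threshold keeps every
   factor with [l != m] on the same side of 0 as [s0 l - lam]. *)
exists 0, (\prod_(l | l != m) Num.min 1 (`|s0 l - lam| / (K + 1))).
have K1 : 0 < K + 1 by rewrite ltr_wpDl.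
split=> //.
  by apply: prodr_gt0 => l lm; rewrite lt_min ltr01 divr_gt0 ?sep.
move=> s t d d_ge0 dlt hs ht hm; rewrite mul0r oppr0 -big_split /=.
apply: prodr_ge0 => l _; case: (eqVneq l m) => [->//|lm].
have small : K * d <= `|s0 l - lam|.
  have dl : d <= `|s0 l - lam| / (K + 1).
    apply: le_trans (ltW dlt) _; rewrite (bigD1 l) //=.
    rewrite -[X in _ <= X]mulr1 ler_pM ?prodr_ge0 //.
    - by rewrite le_min ler01 divr_ge0 // ltW.
    - by move=> i _; rewrite le_min ler01 divr_ge0 // ltW.
    - by rewrite ge_min lexx orbT.
    - suff /andP[] : 0 <= \prod_(i | (i != m) && (i != l)) Num.min 1 (`|s0 i - lam| / (K + 1)) <= 1 by [].
      apply: (big_ind (fun x => 0 <= x <= 1)) => [|x y /andP[? ?] /andP[? ?]|i _].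
      + by rewrite ler01 lexx.
      + by rewrite mulr_ge0 ?mulr_ile1.
      + by rewrite le_min ler01 divr_ge0 ?ge_min ?lexx // ltW.
  rewrite (le_trans _ (_ : (K + 1) * d <= _)) // ?ler_wpM2r ?lerDl //.
  by move: dl; rewrite ler_pdivlMr // mulrC.
have hh u : `|u - s0 l| <= K * d -> 0 <= (u - lam) * (s0 l - lam).
  move=> hu; have := le_trans hu small.
  have [h|h] := leP 0 (s0 l - lam); rewrite ?(ger0_norm h) ?(ltr0_norm h) => /ler_normlP[h1 h2].
    by rewrite mulr_ge0 //; lra.
  by apply: mulr_le0; lra.
have := mulr_ge0 (hh _ (hs l)) (hh _ (ht l)).
have -> : (s l - lam) * (s0 l - lam) * ((t l - lam) * (s0 l - lam)) =
   ((s l - lam) * (t l - lam)) * (s0 l - lam) ^+ 2 by ring.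
by rewrite pmulr_lge0 // exprn_even_gt0 //= -normr_gt0 sep.
Qed.

Lemma det_sub_spectrum (R : rcfType) N (A : 'M[R[i]]_N) (s : seq R) (lam : R) :
  char_poly A = \prod_(x <- s) ('X - (x%:C)%C%:P) ->
  \det (A - (lam%:C)%C%:M) = (\prod_(l < N) (nth 0 s l - lam))%:C%C.
Proof.
move=> sA; have sN := size_spectrum _ _ _ _ sA.
have -> : A - (lam%:C)%C%:M = - ((lam%:C)%C%:M - A) by rewrite opprB.
rewrite -scaleN1r detZ.
have -> : \det ((lam%:C)%C%:M - A) = (char_poly A).[(lam%:C)%C].
  rewrite -[RHS]/(horner_eval _ _) /char_poly -det_map_mx; congr (\det _).
  apply/matrixP => i j; rewrite !mxE -[RHS]/(('X *+ (i == j) - (A i j)%:P).[(lam%:C)%C]).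
  by rewrite hornerD hornerN hornerMn hornerX hornerC.
rewrite sA horner_prod (big_nth 0) sN big_mkord -[X in _ ^+ X]card_ord -prodr_const -big_split rmorph_prod /=.
by apply: eq_bigr => l _; rewrite hornerXsubC rmorphB /=; ring.
Qed.


Lemma unit_conj (C : numClosedFieldType) (z : C) : `|z| = 1 -> Num.conj z = z^-1.
Proof. by move=> z1; rewrite invC_norm z1 expr1n invr1 mul1r. Qed.

(** As [z] tends to 1 along [Z], [G] tends to [|g(w0)|^2] while its upper bound tends to 0. Since
    [conj g(w0 conj z)] is a polynomial in [z], the convergence is quantified by
    [poly_lipschitz_root]. *)
Lemma circle_root (C : numClosedFieldType) (g : {poly C}) (w0 c d0 : C) (N : nat) (Z : C -> Prop) :
  `|w0| = 1 -> (0 < N)%N -> 0 <= c -> 0 < d0 ->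
  (forall e : C, 0 < e -> exists z, [/\ Z z, `|z| = 1, z != 1 & `|z - 1| < e]) ->
  (forall z, Z z -> z != 1 -> `|z - 1| < d0 ->
     let G := z * (g.[w0 * z] * Num.conj g.[w0 * Num.conj z]) / z ^+ N.*2 in
     G \is Num.real /\ G <= c * `|z - 1| ^+ 2) ->
  g.[w0] = 0.
Proof.
move=> w01 N0 c0 d00 Zd HG; apply/eqP; apply: contraT => g0.
pose gb := map_poly Num.conj g.
pose Kp := (g \Po (w0 *: 'X)) * (gb \Po (Num.conj w0 *: 'X)).
have KpE z : `|z| = 1 -> Kp.[z] = g.[w0 * z] * Num.conj g.[w0 * Num.conj z].
  move=> z1; rewrite /Kp /gb hornerM !horner_comp !hornerE.
  by rewrite -horner_map /= rmorphM /= conjCK.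
(* On the circle [K2] is [G - |g(w0)|^2] times a power of [z], and it vanishes at 1. *)
pose K2 := Kp - (`|g.[w0]| ^+ 2) *: 'X^(N.*2.-1).
have [b b0 HK2] : exists2 K : C, 0 <= K & forall x, `|x - 1| <= 1 -> `|K2.[x]| <= K * `|x - 1|.
  apply: poly_lipschitz_root; rewrite /K2 hornerD hornerN KpE ?normr1 // hornerZ hornerXn.
  by rewrite conjC1 expr1n !mulr1 normCK subrr.
pose a := `|g.[w0]| ^+ 2; have a0 : 0 < a by rewrite exprn_gt0 // normr_gt0.
have B0 : 0 < c + b + 1 by rewrite ltr_wpDl // addr_ge0.
have B1 : 0 < (a + d0 + 1) * (c + b + 1) * (d0 + 1).
  by rewrite !mulr_gt0 // !addr_gt0.
(* A single radius that yields [d < d0], [d <= 1] and [d * (c + b + 1) < a] together; the last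
   contradicts [a <= c d^2 + b d]. *)
have [z [Zz zu z1 zlt]] := Zd (a * d0 / ((a + d0 + 1) * (c + b + 1) * (d0 + 1))) (divr_gt0 (mulr_gt0 a0 d00) B1).
set d := `|z - 1| in zlt.
have d_ge0 : 0 <= d by rewrite normr_ge0.
have zlt2 : d * ((a + d0 + 1) * (c + b + 1) * (d0 + 1)) < a * d0 by rewrite -ltr_pdivlMr.
set A := a + d0 + 1 in B1 zlt2; set B := c + b + 1 in B0 B1 zlt2; set D := d0 + 1 in B1 zlt2.
have A1 : 1 <= A by rewrite lerDr addr_ge0 // ltW.
have Ba1 : 1 <= B by rewrite lerDr addr_ge0.
have D1 : 1 <= D by rewrite lerDr ltW.
have aA : a <= A by rewrite /A -addrA lerDl addr_ge0 // ltW.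
have dD : d0 <= D by rewrite lerDl.
have BD1 : 1 <= B * D by rewrite mulr_ege1.
have aABD : a <= A * B * D.
  by rewrite -mulrA (le_trans aA) // ler_peMr // (le_trans _ A1).
have A0 := lt_le_trans ltr01 A1; have D0 := lt_le_trans ltr01 D1.
have dd0 : d < d0.
  rewrite -(ltr_pM2l a0); apply: le_lt_trans zlt2; by rewrite mulrC ler_wpM2l.
have dle1 : d <= 1.
  rewrite -(ler_pM2r B1) mul1r (le_trans (ltW zlt2)) // -mulrA ler_pM ?(ltW a0) ?(ltW d00) //.
  by rewrite mulrC (le_trans dD) // ler_peMr // ltW.
have dBa : d * B < a.
  have AD0 : 0 < A * D by rewrite mulr_gt0.
  rewrite -(ltr_pM2r AD0); have -> : d * B * (A * D) = d * (A * B * D) by ring.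
  by apply: lt_le_trans zlt2 _; rewrite ler_pM2l // (le_trans dD) // mulrC ler_peMr // ltW.
have zn : z != 0 by rewrite -normr_eq0 zu oner_eq0.
pose G := z * Kp.[z] / z ^+ N.*2.
have [Gr Gle] : G \is Num.real /\ G <= c * d ^+ 2 by rewrite /G KpE //; exact: HG.
have K2E : K2.[z] = z ^+ N.*2.-1 * (G - a).
  rewrite /K2 hornerD hornerN hornerZ hornerXn mulrBr [a * _]mulrC; congr (_ - _).
  rewrite /G -[N.*2 in X in _ = _ * X]prednK ?double_gt0 // exprS; set w := z ^+ _.
  have wn : w != 0 by rewrite expf_neq0.
  by field; rewrite zn wn.
have := HK2 _ dle1; rewrite K2E normrM normrX zu expr1n mul1r -/d distrC => le1.
have ar : a \is Num.real by rewrite gtr0_real.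
have le2 : a - G <= b * d by apply: le_trans le1; rewrite real_ler_norm // rpredB.
have le3 : a <= c * d ^+ 2 + b * d.
  by rewrite -[a](subrK G) [_ - G + G]addrC lerD.
have le4 : a <= d * B.
  apply: le_trans le3 _; rewrite -subr_ge0 /B.
  have -> : d * (c + b + 1) - (c * d ^+ 2 + b * d) = c * d * (1 - d) + d by ring.
  by rewrite addr_ge0 // !mulr_ge0 // subr_ge0.
by have := le_lt_trans le4 dBa; rewrite ltxx.
Qed.

Section DoubleRoot.
Variable R : rcfType.
Local Notation C := (R[i]).
Local Notation "M ^t*" := (map_mx Num.conj (trmx M)) (at level 30).
Local Notation "x %:C" := (x%:C)%C.

(** Write [p = g (X - w0)]. The product of the determinants at [z] and [conj z] equals [- d^2 G]
    with [d = |z - 1|] and [G] as in [circle_root]. Extremality and Weyl's bound make this product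
    at least [- c d^4], hence [G <= c d^2] and [g(w0) = 0]. *)
Lemma extremal_double_root N (m : 'I_N) (Z : C -> Prop) (A : C -> 'M[C]_N) (p : {poly C})
    (w0 : C) (lam K : R) (s0 : seq R) :
  `|w0| = 1 -> 0 <= K -> Z 1 ->
  (forall z, Z z -> `|z| = 1) -> (forall z, Z z -> Z (Num.conj z)) ->
  (forall e : C, 0 < e -> exists z, [/\ Z z, z != 1 & `|z - 1| < e]) ->
  (forall z, Z z -> (A z) ^t* = A z) ->
  (forall z, Z z -> forall i j, `|(A z - A 1) i j| <= K%:C * `|z - 1|) ->
  (forall z, Z z -> \det (A z - (lam%:C)%:M) * (w0 * z) ^+ N = p.[w0 * z]) ->
  sorted <=%R s0 -> char_poly (A 1) = \prod_(x <- s0) ('X - (x%:C)%:P) -> nth 0 s0 m = lam ->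
  (forall z1 z2 s t, Z z1 -> Z z2 ->
    sorted <=%R s -> char_poly (A z1) = \prod_(x <- s) ('X - (x%:C)%:P) ->
    sorted <=%R t -> char_poly (A z2) = \prod_(x <- t) ('X - (x%:C)%:P) ->
    0 <= (nth 0 s m - lam) * (nth 0 t m - lam)) ->
  p.[w0] = 0 /\ p^`().[w0] = 0.
Proof.
move=> w01 K0 Z1 Zu Zc Zd Ah AK Ap so0 sA0 s0m ext.
have detE z s : char_poly (A z) = \prod_(x <- s) ('X - (x%:C)%:P) ->
  \det (A z - (lam%:C)%:M) = (\prod_(l < N) (nth 0 s l - lam))%:C by exact: det_sub_spectrum.
have p0 : p.[w0] = 0.
  rewrite -[w0]mulr1 -Ap // (detE _ _ sA0) (bigD1 m) //= s0m subrr mul0r rmorph0 mul0r //.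
split=> //; have /factor_theorem[g pE] : root p w0 by apply/eqP.
have -> : p^`().[w0] = g.[w0].
  by rewrite pE derivM hornerD !hornerM !hornerXsubC derivXsubC subrr mulr0 add0r hornerE mulr1.
have w0n : w0 != 0 by rewrite -normr_eq0 w01 oner_eq0.
have [c [d0 [c0 d00 HC]]] := extremal_prod_ge _ _ m (fun l => nth 0 s0 l) _ _ (mulr_ge0 (ler0n R N) K0) s0m.
have N0 : (0 < N)%N by apply: leq_ltn_trans (ltn_ord m).
apply: (circle_root C g w0 c%:C d0%:C N Z) => //; rewrite ?ler0c //.
  by rewrite -[0]/((0 : R)%:C) ltcR.
  by move=> e /Zd[z [Zz z1 ze]]; exists z; rewrite Zu.
move=> z Zz z1 zd0 G.
have [d dE] : exists d : R, `|z - 1| = d%:C by apply/complex_realP; rewrite normr_real.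
have dge0 : 0 <= d by rewrite -ler0c -dE.
have dlt : d < d0 by rewrite -ltcR -dE.
have Zzc := Zc _ Zz; have zu := Zu _ Zz.
have zn : z != 0 by rewrite -normr_eq0 zu oner_eq0.
have dcE : `|Num.conj z - 1| = d%:C by rewrite -dE -[RHS]norm_conjC rmorphB rmorph1.
have [s [so sA]] := herm_sorted_spectrum _ _ _ (Ah _ Zz).
have [t [to tA]] := herm_sorted_spectrum _ _ _ (Ah _ Zzc).
(* Weyl's inequality in both directions; the factor [N] converts an entrywise bound into an
   eigenvalue bound. *)
have near u s1 : Z u -> `|u - 1| = d%:C -> sorted <=%R s1 -> char_poly (A u) = \prod_(x <- s1) ('X - (x%:C)%:P) ->
  forall l : 'I_N, `|nth 0 s1 l - nth 0 s0 l| <= N%:R * K * d.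
  move=> Zu' du so1 sA1 l; rewrite ler_distlC -mulrA.
  have H1 := @weyl_le R N (A 1) (A u) s0 s1 (K * d) (Ah _ Z1) (Ah _ Zu') so0 sA0 so1 sA1.
  have H2 := @weyl_le R N (A u) (A 1) s1 s0 (K * d) (Ah _ Zu') (Ah _ Z1) so1 sA1 so0 sA0.
  have e1 i j : `|(A u - A 1) i j| <= (K * d)%:C by rewrite rmorphM /= -du AK.
  have e2 i j : `|(A 1 - A u) i j| <= (K * d)%:C.
    by have := e1 i j; rewrite !mxE distrC.
  by rewrite lerBlDr H2 // H1.
have := HC (fun l => nth 0 s l) (fun l => nth 0 t l) d dge0 dlt (near _ _ Zz dE so sA)
   (near _ _ Zzc dcE to tA) (ext _ _ _ _ Zz Zzc so sA to tA).
set P1 := \prod_l _; set P2 := \prod_l _ => HP.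
have F1 := Ap _ Zz; rewrite (detE _ _ sA) -/P1 in F1.
have F2 := Ap _ Zzc; rewrite (detE _ _ tA) -/P2 in F2.
have dn : d%:C != 0 by rewrite -dE normr_eq0 subr_eq0.
have FE : (P1 * P2)%:C = - (d%:C ^+ 2 * G).
  have w0c := unit_conj _ _ w01; have zc := unit_conj _ _ zu.
  have {}F2 : P2%:C * (w0^-1 * z) ^+ N = Num.conj g.[w0 * Num.conj z] * (w0^-1 * (z - 1)).
    have := congr1 Num.conj F2.
    rewrite pE rmorphM rmorphXn hornerM hornerXsubC !rmorphM /= rmorphB /= rmorphM /= conjCK w0c.
    have -> : w0^-1 * (z - 1) = w0^-1 * z - w0^-1 by rewrite mulrBr mulr1.
    move=> <-; congr (_ * _).
    by rewrite -[RHS]/(P2%:C^*)%C conjc_real.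
  rewrite pE hornerM hornerXsubC in F1.
  have E1 : P1%:C = g.[w0 * z] * (w0 * z - w0) / (w0 * z) ^+ N.
    by rewrite -F1 mulfK // expf_neq0 // mulf_neq0.
  have E2 : P2%:C = Num.conj g.[w0 * Num.conj z] * (w0^-1 * (z - 1)) / (w0^-1 * z) ^+ N.
    by rewrite -F2 mulfK // expf_neq0 // mulf_neq0 ?invr_eq0.
  (* On the circle [|z - 1|^2 = - (z - 1)^2 / z]: this is the source of the minus sign and of the
     extra factor [z] in [G]. *)
  have d2 : d%:C ^+ 2 = (z - 1) * (z^-1 - 1) by rewrite -dE normCK rmorphB rmorph1 /= zc.
  rewrite rmorphM /= E1 E2 d2 /G -addnn exprD !exprMn exprVn.
  have zN : z ^+ N != 0 by rewrite expf_neq0.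
  have wN : w0 ^+ N != 0 by rewrite expf_neq0.
  move: (Num.conj _) (g.[_]) (z ^+ N) (w0 ^+ N) zN wN => x y ZN WN zN wN.
  by field; rewrite zn w0n zN wN.
have Gr : G = (- (P1 * P2) / d ^+ 2)%:C.
  by rewrite rmorphM rmorphN /= FE opprK fmorphV rmorphXn /= mulrC mulKf // expf_neq0.
split; first by rewrite Gr; apply/complex_realP; eexists.
rewrite Gr dE -rmorphXn -rmorphM lecR ler_pdivrMr ?exprn_gt0 //.
  by rewrite lerNl -mulrA -exprD.
by rewrite lt_def dge0 andbT; apply: contraNneq dn => ->.
Qed.
End DoubleRoot.

(** * Discriminants and Laurent polynomials *)

Section DoubleRootMatrix.
Variable C : fieldType.

(** A square substitute for the discriminant: the rows are the coefficients of [X^i p] and [X^i p']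
    for [i < n]. The Sylvester matrix of a [p] of degree [n] and [p'] has one multiple of [p] fewer;
    here both blocks have [n] rows. *)
Definition sylv n (p : {poly C}) : 'M[C]_(n + n) :=
  \matrix_(a, b) match fintype.split a with
                 | inl i => ('X^i * p)`_b
                 | inr i => ('X^i * p^`())`_b end.

(** Every row polynomial vanishes at [x], so the vector of powers of [x] lies in the kernel. *)
Lemma det_sylv_double_root n (p : {poly C}) x : (0 < n)%N -> (size p <= n.+1)%N ->
  p.[x] = 0 -> p^`().[x] = 0 -> \det (sylv n p) = 0.
Proof.
move=> n0 sp px dpx; rewrite -det_tr; apply/eqP/det0P.
exists (\row_(b < n + n) x ^+ b).
  have nn : (0 < n + n)%N by rewrite addn_gt0 n0.
  by apply/eqP => /rowP /(_ (Ordinal nn)); rewrite !mxE /= => /eqP; rewrite expr0 oner_eq0.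
apply/rowP => a; rewrite !mxE.
have E (q : {poly C}) : (size q <= n + n)%N -> q.[x] = 0 ->
    \sum_(b < n + n) x ^+ b * q`_b = 0.
  by move=> sq qx; rewrite -[RHS]qx (horner_coef_wide _ sq); apply: eq_bigr => b _; rewrite mulrC.
under eq_bigr do rewrite !mxE.
have sd : (size p^`() <= n)%N.
  by rewrite (leq_trans (size_poly _ _)) // -subn1 leq_subLR add1n.
case: (fintype.split a) => i; apply: E; rewrite ?hornerM ?px ?dpx ?mulr0 //;
  rewrite (leq_trans (size_mul_leq _ _)) // size_polyXn addSn /=.
- by move: (ltn_ord i) sp; move: (size p) (nat_of_ord i) => a0 b0; lia.
- by move: (ltn_ord i) sd; move: (size _) (nat_of_ord i) => a0 b0; lia.
Qed.

(** A kernel vector is a relation [u p + w p' = 0] with [u] and [w] of degree below [n]. Coprimality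
    gives [p | w], so [w = 0] by degree, and then [u = 0]. *)
Lemma det_sylv_separable n (p : {poly C}) : size p = n.+1 -> separable_poly p ->
  \det (sylv n p) != 0.
Proof.
move=> sp sep; apply/det0P => -[v vn0 /rowP v0].
pose u := rVpoly (lsubmx v); pose w := rVpoly (rsubmx v).
have su : (size u <= n)%N by exact: size_poly.
have sw : (size w <= n)%N by exact: size_poly.
have sd : (size p^`() <= n)%N.
  by rewrite (leq_trans (size_poly _ _)) // sp.
have uw : u * p + w * p^`() = 0.
  apply/polyP => b; rewrite coef0.
  have [bn|bn] := ltnP b (n + n); last first.
    rewrite nth_default // (leq_trans _ bn) // (leq_trans (size_polyD _ _)) // geq_max.
    rewrite !(leq_trans (size_mul_leq _ _)) // ?sp ?addnS /= ?leq_add //.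
    by rewrite (leq_trans (leq_pred _)) // leq_add.
  have := v0 (Ordinal bn); rewrite !mxE big_split_ord /= => E; rewrite -[RHS]E.
  rewrite coefD /u /w /rVpoly !poly_def !mulr_suml !coef_sum; congr (_ + _);
    apply: eq_bigr => i _; rewrite insubT //= => ilt; rewrite !mxE.
  - have -> : Sub (nat_of_ord i) ilt = i by apply: val_inj.
    by rewrite (unsplitK (inl i)) -scalerAl coefZ.
  - have -> : Sub (nat_of_ord i) ilt = i by apply: val_inj.
    by rewrite (unsplitK (inr i)) -scalerAl coefZ.
have pw : p %| w.
  have cop : coprimep p p^`() by move: sep; rewrite unlock.
  rewrite -(Gauss_dvdpl _ cop); apply/dvdpP; exists (- u).
  by rewrite mulNr; apply/eqP; rewrite -addr_eq0 addrC uw.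
have w0 : w = 0.
  apply/eqP; apply: contraTT pw => wn; apply/negP => /(dvdp_leq wn).
  by rewrite sp leqNgt ltnS sw.
have u0 : u = 0.
  move/eqP: uw; rewrite w0 mul0r addr0 mulf_eq0 => /orP[/eqP//|/eqP p0].
  by move: sp; rewrite p0 size_poly0.
case/negP: vn0; rewrite -[v]hsubmxK; apply/eqP.
have {}u0 : lsubmx v = 0 by rewrite -[lsubmx v]rVpolyK -/u u0 linear0.
have {}w0 : rsubmx v = 0 by rewrite -[rsubmx v]rVpolyK -/w w0 linear0.
by rewrite u0 w0 row_mx0.
Qed.
End DoubleRootMatrix.

Section Laurent.
Variables (C : fieldType) (d : nat) (j : 'I_d).
Local Notation expo := {ffun 'I_d -> int}.

Definition monom (w : 'I_d -> C) (a : expo) : C := \prod_i w i ^ a i.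

(** Laurent polynomials in the [w i] with [i != j], viewed as functions on the points with nonzero
    coordinates. The representation stays existential, so closure under sums, products and
    determinants is all that is needed to recognise one. *)
Definition laurent (f : ('I_d -> C) -> C) : Prop :=
  exists s : seq (C * expo), all (fun x : C * expo => x.2 j == 0) s /\
    forall w, (forall i, w i != 0) -> f w = \sum_(x <- s) x.1 * monom w x.2.

Lemma laurent_ext f g : (forall w, (forall i, w i != 0) -> f w = g w) -> laurent g -> laurent f.
Proof. by move=> fg [s [sj sE]]; exists s; split=> // w w0; rewrite fg // sE. Qed.

Lemma laurent_cst c : laurent (fun=> c).
Proof.
exists [:: (c, [ffun=> 0])]; split=> [|w w0]; first by rewrite /= ffunE eqxx.
by rewrite big_seq1 /monom big1 ?mulr1 // => i _; rewrite ffunE expr0z.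
Qed.

Lemma laurent_expz i (n : int) : i != j -> laurent (fun w => w i ^ n).
Proof.
move=> ij; exists [:: (1, [ffun k => if k == i then n else 0])]; split=> [|w w0].
  by rewrite /= ffunE [j == i]eq_sym (negbTE ij) eqxx.
rewrite big_seq1 /monom mul1r (bigD1 i) //= ffunE eqxx big1 ?mulr1 // => k ki.
by rewrite ffunE (negbTE ki) expr0z.
Qed.

Lemma laurentD f g : laurent f -> laurent g -> laurent (fun w => f w + g w).
Proof.
move=> [s [sj sE]] [t [tj tE]]; exists (s ++ t); split=> [|w w0]; first by rewrite all_cat sj.
by rewrite big_cat /= sE // tE.
Qed.

Lemma laurentM f g : laurent f -> laurent g -> laurent (fun w => f w * g w).
Proof.
move=> [s [sj sE]] [t [tj tE]].
exists [seq (x.1 * y.1, [ffun i => x.2 i + y.2 i] : expo) | x : C * expo <- s, y : C * expo <- t]; split=> [|w w0].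
  apply/allP => _ /allpairsP[[x y] /= [xs yt ->]] /=.
  by rewrite ffunE (eqP (allP sj _ xs)) (eqP (allP tj _ yt)).
rewrite sE // tE // big_allpairs_dep mulr_suml; apply: eq_bigr => x _.
rewrite mulr_sumr; apply: eq_bigr => y _ /=.
have -> : monom w [ffun i => x.2 i + y.2 i] = monom w x.2 * monom w y.2.
  by rewrite /monom -big_split /=; apply: eq_bigr => i _; rewrite ffunE expfzDr.
by rewrite mulrACA.
Qed.

Lemma laurent_sum I (r : seq I) (P : pred I) F : (forall i, P i -> laurent (F i)) ->
  laurent (fun w => \sum_(i <- r | P i) F i w).
Proof.
move=> HF; elim: r => [|i r IH].
  by apply: laurent_ext (laurent_cst 0) => w _; rewrite big_nil.
case Pi: (P i).
  apply: laurent_ext (laurentD _ _ (HF _ Pi) IH) => w _; by rewrite big_cons Pi.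
by apply: laurent_ext IH => w _; rewrite big_cons Pi.
Qed.

Lemma laurent_prod I (r : seq I) (P : pred I) F : (forall i, P i -> laurent (F i)) ->
  laurent (fun w => \prod_(i <- r | P i) F i w).
Proof.
move=> HF; elim: r => [|i r IH].
  by apply: laurent_ext (laurent_cst 1) => w _; rewrite big_nil.
case Pi: (P i).
  apply: laurent_ext (laurentM _ _ (HF _ Pi) IH) => w _; by rewrite big_cons Pi.
by apply: laurent_ext IH => w _; rewrite big_cons Pi.
Qed.

Lemma laurent_det n (M : ('I_d -> C) -> 'M[C]_n) :
  (forall a b, laurent (fun w => M w a b)) -> laurent (fun w => \det (M w)).
Proof.
move=> HM; apply: laurent_sum => s _; apply: laurentM; first exact: laurent_cst.
by apply: laurent_prod => i _.
Qed.

Definition laurent_poly (f : ('I_d -> C) -> {poly C}) := forall b, laurent (fun w => (f w)`_b).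

Lemma laurent_poly_cst p : laurent_poly (fun=> p).
Proof. by move=> b; apply: laurent_cst. Qed.

Lemma laurent_polyC f : laurent f -> laurent_poly (fun w => (f w)%:P).
Proof.
move=> Lf b; apply: (laurent_ext _ (fun w => f w * (b == 0)%:R)) => [w _|].
  by rewrite coefC; case: eqP; rewrite ?mulr1 ?mulr0.
by apply: laurentM (laurent_cst _).
Qed.

Lemma laurent_polyD f g : laurent_poly f -> laurent_poly g -> laurent_poly (fun w => f w + g w).
Proof.
by move=> Hf Hg b; apply: laurent_ext (laurentD _ _ (Hf b) (Hg b)) => w _; rewrite coefD.
Qed.

Lemma laurent_polyM f g : laurent_poly f -> laurent_poly g -> laurent_poly (fun w => f w * g w).
Proof.
move=> Hf Hg b; apply: (laurent_ext _ (fun w => \sum_(i < b.+1) (f w)`_i * (g w)`_(b - i))).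
  by move=> w _; rewrite coefM.
by apply: laurent_sum => i _; apply: laurentM.
Qed.

Lemma laurent_poly_sum I (r : seq I) (P : pred I) F : (forall i, P i -> laurent_poly (F i)) ->
  laurent_poly (fun w => \sum_(i <- r | P i) F i w).
Proof.
move=> HF b; apply: (laurent_ext _ (fun w => \sum_(i <- r | P i) (F i w)`_b)).
  by move=> w _; rewrite coef_sum.
by apply: laurent_sum => i Pi; apply: HF.
Qed.

Lemma laurent_poly_prod I (r : seq I) (P : pred I) F : (forall i, P i -> laurent_poly (F i)) ->
  laurent_poly (fun w => \prod_(i <- r | P i) F i w).
Proof.
move=> HF; elim: r => [|i r IH] b.
  by apply: laurent_ext (laurent_cst ((1 : {poly C})`_b)) => w _; rewrite big_nil.
case Pi: (P i).
  apply: laurent_ext (laurent_polyM _ _ (HF _ Pi) IH b) => w _; by rewrite big_cons Pi.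
by apply: laurent_ext (IH b) => w _; rewrite big_cons Pi.
Qed.

Lemma laurent_poly_det n (M : ('I_d -> C) -> 'M[{poly C}]_n) :
  (forall a b, laurent_poly (fun w => M w a b)) -> laurent_poly (fun w => \det (M w)).
Proof.
move=> HM; apply: laurent_poly_sum => s _; apply: laurent_polyM; first exact: laurent_poly_cst.
by apply: laurent_poly_prod => i _.
Qed.

Lemma laurent_det_sylv n f : laurent_poly f -> laurent (fun w => \det (sylv C n (f w))).
Proof.
move=> Hf; apply: laurent_det => a b; apply: (laurent_ext _ (fun w =>
  match fintype.split a with inl i => ('X^i * f w)`_b | inr i => ('X^i * (f w)^`())`_b end)).
  by move=> w _; rewrite mxE.
case: (fintype.split a) => i; apply: laurent_polyM; try exact: laurent_poly_cst; first exact: Hf.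
move=> k; apply: (laurent_ext _ (fun w => (f w)`_k.+1 * k.+1%:R)).
  by move=> w _; rewrite coef_deriv mulr_natr.
by apply: laurentM (laurent_cst _); apply: Hf.
Qed.

(** Terms with equal exponents are merged; the elimination in [laurent_vanish] relies on distinct
    exponents. *)
Lemma laurent_uniq f : laurent f -> exists s : seq (C * expo),
  [/\ all (fun x : C * expo => x.2 j == 0) s, uniq (map snd s) &
    forall w, (forall i, w i != 0) -> f w = \sum_(x <- s) x.1 * monom w x.2].
Proof.
move=> [s [sj sE]]; pose es := undup (map snd s).
exists [seq (\sum_(x <- s | x.2 == a) x.1, a) | a <- es]; split.
- rewrite all_map; apply/allP => a; rewrite mem_undup => /mapP[x xs ->] /=.
  exact: (allP sj).
- by rewrite -map_comp map_id undup_uniq.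
- move=> w w0; rewrite sE // big_map /=.
  under [RHS]eq_bigr do rewrite mulr_suml.
  rewrite (exchange_big_dep xpredT) //= big_seq [RHS]big_seq; apply: eq_bigr => x xs.
  have xe : x.2 \in es by rewrite mem_undup map_f.
  rewrite big_mkcond (bigD1_seq x.2) ?undup_uniq //= eqxx big1 ?addr0 // => a ax.
  by rewrite eq_sym (negbTE ax).
Qed.
End Laurent.

(** * Laurent polynomials vanishing on a patch *)

Section CircleExp.
Variable R : realType.
Local Notation e := (@cexp2pi R).

Lemma cexpD s t : e (s + t) = e s * e t.
Proof.
rewrite /cexp2pi mulrDr cosD sinD; apply/eqP; rewrite eq_complex /=; apply/andP; split; apply/eqP; ring.
Qed.

Lemma cexp0 : e 0 = 1.
Proof. by rewrite /cexp2pi mulr0 cos0 sin0. Qed.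

Lemma cexp_neq0 t : e t != 0.
Proof.
apply/negP => /eqP e0; have := cexpD t (- t); rewrite e0 mul0r subrr cexp0.
by move/eqP; rewrite oner_eq0.
Qed.

Lemma cexpN t : e (- t) = (e t)^-1.
Proof. by apply: (mulfI (cexp_neq0 t)); rewrite -cexpD subrr cexp0 divff ?cexp_neq0. Qed.

Lemma cexp_norm t : `|e t| = 1.
Proof. by rewrite normc_def /= cos2Dsin2 sqrtr1. Qed.

Lemma cexpMn t n : e (t *+ n) = e t ^+ n.
Proof. by elim: n => [|n IH]; rewrite ?mulr0n ?cexp0 // mulrS cexpD IH exprS. Qed.

Lemma cexpMz t (n : int) : e (t *~ n) = e t ^ n.
Proof.
case: n => n; first exact: cexpMn.
by rewrite NegzE mulrNz cexpN -pmulrn cexpMn exprnN.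
Qed.

Lemma cexp_sum I (r : seq I) (P : pred I) (F : I -> R) :
  e (\sum_(i <- r | P i) F i) = \prod_(i <- r | P i) e (F i).
Proof. exact: (big_morph _ cexpD cexp0). Qed.

Lemma cexp1 : e 1 = 1.
Proof. by rewrite /cexp2pi mulr1 mulr_natl cos2pi sin2pi. Qed.

Lemma cexp_int (n : int) : e (n%:~R) = 1.
Proof. by rewrite cexpMz cexp1 exp1rz. Qed.
End CircleExp.

Section LaurentVanish.
Variables (R : realType) (d : nat) (j : 'I_d).
Local Notation C := (R[i]).
Local Notation e := (@cexp2pi R).
Local Notation expo := {ffun 'I_d -> int}.

(** The index [j] is left out because the exponents there are zero and the curves followed below
    control only the other coordinates. *)
Definition phase (a : expo) (x : 'I_d -> R) : R := \sum_(i | i != j) x i *~ a i.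

Lemma monom_cexp (a : expo) (x : 'I_d -> R) : a j = 0 ->
  monom C d (fun i => e (x i)) a = e (phase a x).
Proof.
move=> aj; rewrite /monom (bigD1 j) //= aj expr0z mul1r cexp_sum.
by apply: eq_bigr => i _; rewrite cexpMz.
Qed.

Lemma phase_derive (a : expo) (g : R -> 'I_d -> R) (i : 'I_d) : i != j ->
  (forall k, k != j -> is_derive (0 : R) 1 (fun h => g h k) ((k == i)%:R : R)) ->
  is_derive (0 : R) 1 (fun h => phase a (g h)) ((a i)%:~R : R).
Proof.
move=> ij Hg; rewrite /phase.
have -> : (fun h => \sum_(k | k != j) g h k *~ a k) =
   \sum_(k < d) (if k != j then (a k)%:~R \*: (fun h => g h k) else cst 0).
  apply/funext => h; rewrite fct_sumE big_mkcond; apply: eq_bigr => k _.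
  by case: ifP => //= _; rewrite -[LHS]mulrzl.
have -> : (a i)%:~R = \sum_(k < d) (if k != j then (a k)%:~R *: ((k == i)%:R : R) else 0).
  rewrite (bigD1 i) //= ij eqxx big1 => [|k ki]; first by rewrite addr0 scaler1.
  by case: ifP => // _; rewrite (negbTE ki) scaler0.
apply: is_derive_sum => k; case: ifP => kj; last exact: is_derive_cst.
exact/is_deriveZ/Hg.
Qed.

Local Notation cRe := complex.Re.
Local Notation cIm := complex.Im.

Lemma trig_derive (th : R -> R) (D : R) (c : C) : is_derive (0 : R) 1 th D ->
  is_derive (0 : R) 1 (fun h => cRe (c * e (th h))) (cRe ((2 * pi)%:C%C * 'i%C * (c * (D%:C)%C * e (th 0)))) /\
  is_derive (0 : R) 1 (fun h => cIm (c * e (th h))) (cIm ((2 * pi)%:C%C * 'i%C * (c * (D%:C)%C * e (th 0)))).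
Proof.
move=> Hth; case: c => a b.
have H2 : is_derive (0 : R) 1 ((2 * pi) \*: th) ((2 * pi) *: D) by exact: is_deriveZ.
have Hc := is_derive1_comp (is_derive_cos (((2 * pi) \*: th) 0)) H2.
have Hs := is_derive1_comp (is_derive_sin (((2 * pi) \*: th) 0)) H2.
split.
- have -> : (fun h => cRe (Complex a b * e (th h))) = a \*: (cos \o ((2 * pi) \*: th)) + (- b) \*: (sin \o ((2 * pi) \*: th)).
    by apply/funext => h /=; rewrite !fctE /= -[_ *: cos _]/(_ * _) -[_ *: sin _]/(_ * _) mulNr.
  apply: is_derive_eq (is_deriveD (is_deriveZ a Hc) (is_deriveZ (- b) Hs)) _.
  by rewrite /= -![_ *: _]/(_ * _); ring.
- have -> : (fun h => cIm (Complex a b * e (th h))) = a \*: (sin \o ((2 * pi) \*: th)) + b \*: (cos \o ((2 * pi) \*: th)).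
    by apply/funext => h /=; rewrite !fctE /= -[_ *: cos _]/(_ * _) -[_ *: sin _]/(_ * _).
  apply: is_derive_eq (is_deriveD (is_deriveZ a Hs) (is_deriveZ b Hc)) _.
  by rewrite /= -![_ *: _]/(_ * _); ring.
Qed.

(** Differentiating each term along the curve brings down [2 pi i] times its [i]-th exponent; the
    common factor is then cancelled. Real and imaginary parts are differentiated separately. *)
Lemma trig_sum_derive (s : seq (C * expo)) (g : R -> 'I_d -> R) (i : 'I_d) : i != j ->
  (forall k, k != j -> is_derive (0 : R) 1 (fun h => g h k) ((k == i)%:R : R)) ->
  (\forall h \near (0 : R), \sum_(x <- s) x.1 * e (phase x.2 (g h)) = 0) ->
  \sum_(x <- s) x.1 * (x.2 i)%:~R * e (phase x.2 (g 0)) = 0.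
Proof.
move=> ij Hg H0.
have [HR HI] : is_derive (0 : R) 1 (fun h => cRe (\sum_(x <- s) x.1 * e (phase x.2 (g h))))
     (cRe ((2 * pi)%:C%C * 'i%C * \sum_(x <- s) x.1 * (x.2 i)%:~R * e (phase x.2 (g 0)))) /\
   is_derive (0 : R) 1 (fun h => cIm (\sum_(x <- s) x.1 * e (phase x.2 (g h))))
     (cIm ((2 * pi)%:C%C * 'i%C * \sum_(x <- s) x.1 * (x.2 i)%:~R * e (phase x.2 (g 0)))).
  elim: s {H0} => [|x s [IHR IHI]].
    rewrite big_nil mulr0; split; (rewrite (_ : (fun h => _) = cst 0); [exact: is_derive_cst|]);
    by apply/funext => h; rewrite big_nil.
  have [TR TI] := trig_derive _ _ x.1 (phase_derive x.2 _ _ ij Hg).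
  rewrite big_cons mulrDr raddfD /= raddfD /=.
  rewrite rmorph_int in TR TI.
  split.
  - rewrite (_ : (fun h => _) = (fun h => cRe (x.1 * e (phase x.2 (g h)))) + (fun h => cRe (\sum_(x <- s) x.1 * e (phase x.2 (g h))))); first exact: is_deriveD.
    by apply/funext => h; rewrite big_cons raddfD.
  - rewrite (_ : (fun h => _) = (fun h => cIm (x.1 * e (phase x.2 (g h)))) + (fun h => cIm (\sum_(x <- s) x.1 * e (phase x.2 (g h))))); first exact: is_deriveD.
    by apply/funext => h; rewrite big_cons raddfD.
set S := (\sum_(x <- s) x.1 * (x.2 i)%:~R * _) in HR HI *.
have zero (f : R -> R) D : is_derive (0 : R) 1 f D -> (\forall h \near (0 : R), f h = 0) -> D = 0.
  move=> fD f0; have c0 : is_derive (0 : R) 1 (cst 0 : R -> R) D.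
    by apply: near_eq_is_derive fD.
  by rewrite -[LHS](@derive_val _ _ _ _ _ _ _ c0) derive_cst.
have HR0 := zero _ _ HR _; have HI0 := zero _ _ HI _.
have : (2 * pi)%:C%C * 'i%C * S = 0.
  apply/eqP; rewrite eq_complex HR0 ?HI0 ?eqxx //.
  - by apply: filterS H0 => h ->.
  - by apply: filterS H0 => h ->.
move/eqP; rewrite !mulf_eq0 => /orP[/orP[]|/eqP //].
- by rewrite eq_complex /= mulf_eq0 pnatr_eq0 /= gt_eqF ?pi_gt0.
- by rewrite eq_complex /= oner_eq0 andbF.
Qed.

(** Induction on the number of terms. The curves allow differentiation, without leaving [P], in each
    direction [i != j]; combining the derivative with the original relation eliminates one
    monomial. *)
Lemma laurent_vanish (f : ('I_d -> C) -> C) (P : ('I_d -> R) -> Prop) :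
  laurent C d j f -> (exists x, P x) ->
  (forall x, P x -> forall i, i != j -> exists g : R -> 'I_d -> R,
    [/\ g 0 = x, forall k, k != j -> is_derive (0 : R) 1 (fun h => g h k) ((k == i)%:R : R)
      & \forall h \near (0 : R), P (g h)]) ->
  (forall x, P x -> f (fun i => e (x i)) = 0) ->
  forall w, (forall i, w i != 0) -> f w = 0.
Proof.
move=> /laurent_uniq [s [sj su sE]] [x0 Px0] HP Pf w w0; rewrite sE //.
suff H : forall x, x \in s -> x.1 = 0.
  by rewrite big_seq big1 // => x /H ->; rewrite mul0r.
have {Pf sE w w0 f} : forall x, P x -> \sum_(y <- s) y.1 * e (phase y.2 x) = 0.
  move=> x /Pf; rewrite sE => [E|i]; last exact: cexp_neq0.
  rewrite -[RHS]E big_seq [RHS]big_seq; apply: eq_bigr => y ys.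
  by rewrite monom_cexp //; apply/eqP/(allP sj).
elim: {s}(size s) {-2}s (erefl (size s)) sj su => [|n IH] [|z s] //= [sn] /andP[zj sj] /andP[zs su] H0.
have Hs : forall x, x \in s -> x.1 = 0.
  move=> y ys; have [i iy] : exists i, y.2 i != z.2 i.
    apply/existsP; rewrite -negb_forall; apply: contraNN zs => /forallP E.
    by apply/mapP; exists y => //; apply/ffunP => i; apply/eqP; rewrite eq_sym E.
  have ij : i != j.
    by apply: contraNneq iy => ->; rewrite (eqP (allP sj _ ys)) (eqP zj).
  (* The derivative in direction [i] minus [z.2 i] times the relation itself: the term [z]
     disappears, while the coefficient of [y] is multiplied by a nonzero integer. *)
  pose s' : seq (C * expo) := [seq (x.1 * (x.2 i - z.2 i)%:~R, x.2) | x : C * expo <- s].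
  have s's x : x \in s' -> x.1 = 0.
    apply: (IH s'); rewrite ?size_map //.
    - by rewrite all_map.
    - by rewrite -map_comp.
    move=> x1 Px1; have [g [g0 Hg HPg]] := HP _ Px1 _ ij.
    have := trig_sum_derive (z :: s) g i ij Hg.
    have HP0 : \forall h \near (0 : R), \sum_(x2 <- z :: s) x2.1 * e (phase x2.2 (g h)) = 0.
      by apply: filterS HPg => h; apply: H0.
    move=> /(_ HP0); rewrite g0; have := H0 _ Px1; rewrite !big_cons => /eqP; rewrite addr_eq0 => /eqP E0.
    rewrite mulrAC E0 mulNr => /eqP; rewrite addrC subr_eq0 => /eqP E1.
    rewrite big_map /=; under eq_bigr do rewrite rmorphB /= mulrBr mulrBl.
    rewrite sumrB E1; apply/eqP; rewrite subr_eq0; apply/eqP.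
    by rewrite mulr_suml; apply: eq_bigr => x2 _; rewrite mulrAC.
  have := s's (y.1 * (y.2 i - z.2 i)%:~R, y.2); rewrite map_f //= => /(_ isT) /eqP.
  by rewrite mulf_eq0 intr_eq0 subr_eq0 (negbTE iy) orbF => /eqP.
(* Only the monomial of [z] is left; it is nonzero at any point of [P], so its coefficient is
   zero. *)
move=> x; rewrite inE => /orP[/eqP ->|/Hs //].
have := H0 _ Px0; rewrite big_cons big_seq big1 => [|y /Hs ->]; last by rewrite mul0r.
by move/eqP; rewrite addr0 mulf_eq0 (negbTE (cexp_neq0 _ _)) orbF => /eqP.
Qed.
End LaurentVanish.

(** * Separability for generic multipliers *)

Section QuadDet.
Variables (C : numClosedFieldType) (N : nat).

Definition quad_mx (B A D : 'M[C]_N) : 'M[{poly C}]_N :=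
  \matrix_(a, b) (B a b *: 'X^2 + A a b *: 'X + (D a b)%:P).

Lemma horner_det_quad B A D x :
  (\det (quad_mx B A D)).[x] = \det (x ^+ 2 *: B + x *: A + D).
Proof.
rewrite -[LHS]/(horner_eval x _) -det_map_mx; congr (\det _); apply/matrixP => a b.
rewrite !mxE -[LHS]/((_ *: 'X^2 + _ *: 'X + _%:P).[x]).
by rewrite !hornerD !hornerZ hornerXn hornerX hornerC ![x ^+ _ * _]mulrC ![x * _]mulrC.
Qed.

Lemma size_prod_quad (I : eqType) (r : seq I) (F : I -> {poly C}) :
  (forall i, (size (F i) <= 3)%N) ->
  (size (\prod_(i <- r) F i)%R <= (size r).*2.+1)%N /\
  (\prod_(i <- r) F i)`_(size r).*2 = \prod_(i <- r) (F i)`_2.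
Proof.
move=> sF; elim: r => [|i r [IH1 IH2]]; first by rewrite !big_nil coef1 size_poly1.
rewrite !big_cons /=; split.
  apply: leq_trans (size_mul_leq _ _) _; move: IH1 (sF i).
  by move: (size (F i)) (size (\prod_(k <- r) F k)) (size r) => a b c; lia.
rewrite coefM.
have lt2 : (2 < (size r).*2.+2.+1)%N by lia.
rewrite (bigD1 (Ordinal lt2)) //= [X in _ + X]big1 => [|k kn].
  by rewrite addr0 -IH2; congr (_ * _`_ _); lia.
have [k3|k2] := leqP 3 k; first by rewrite nth_default ?mul0r // (leq_trans (sF i)).
rewrite [X in _ * X]nth_default ?mulr0 // (leq_trans IH1) //.
have : nat_of_ord k != 2%N by apply: contra kn => /eqP k2'; apply/eqP/val_inj.
by move: k2; move: (nat_of_ord k) => a; move: (size r) => b; lia.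
Qed.

Lemma size_det_quad B A D : \det B != 0 ->
  size (\det (quad_mx B A D)) = N.*2.+1 /\ lead_coef (\det (quad_mx B A D)) = \det B.
Proof.
move=> B0.
have sq a b : (size (quad_mx B A D a b) <= 3)%N.
  rewrite mxE (leq_trans (size_polyD _ _)) // geq_max (leq_trans (size_polyD _ _)) /=.
    by rewrite (leq_trans (size_polyC_leq1 _)).
  by rewrite geq_max !(leq_trans (size_scale_leq _ _)) ?size_polyXn ?size_polyX.
have cq a b : (quad_mx B A D a b)`_2 = B a b.
  by rewrite mxE !coefD !coefZ coefXn coefX coefC /= mulr1 mulr0 !addr0.
have prodE (s : {perm 'I_N}) : (size (\prod_i quad_mx B A D i (s i))%R <= N.*2.+1)%N /\
    (\prod_i quad_mx B A D i (s i))`_N.*2 = \prod_i B i (s i).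
  have := size_prod_quad _ (index_enum 'I_N) (fun i => quad_mx B A D i (s i)) (fun i => sq i (s i)).
  rewrite /index_enum -enumT size_enum_ord => -[-> ->]; split=> //.
  by apply: eq_bigr => i _.
have sgnP (n : nat) : (-1) ^+ n = ((-1) ^+ n)%:P :> {poly C} by rewrite polyC_exp polyCN polyC1.
have sle : (size (\det (quad_mx B A D)) <= N.*2.+1)%N.
  apply: leq_trans (size_sum _ _ _) _; apply/bigmax_leqP => s _.
  by rewrite sgnP mul_polyC (leq_trans (size_scale_leq _ _)) //; case: (prodE s).
have cE : (\det (quad_mx B A D))`_N.*2 = \det B.
  rewrite coef_sum; apply: eq_bigr => s _; rewrite sgnP mul_polyC coefZ.
  by congr (_ * _); case: (prodE s).
have sE : size (\det (quad_mx B A D)) = N.*2.+1.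
  apply/eqP; rewrite eqn_leq sle ltnNge; apply/negP => le.
  by move: B0; rewrite -cE nth_default ?eqxx.
by rewrite lead_coefE sE cE.
Qed.

(** At [e = 0] the determinant vanishes at [r], hence it is [O(e)] there. If all [2 N] roots stayed
    at distance at least [eta] from [r], its modulus at [r] would be at least
    [|det B| eta^(2 N)]. *)
Lemma quad_root_near B A0 E1 E2 E3 r : \det B != 0 -> \det (r *: B + A0) = 0 ->
  forall eta : C, 0 < eta -> exists2 delta, 0 < delta & forall e, 0 < e -> e < delta ->
    exists2 s, root (\det (quad_mx B (A0 + e *: E1 + e ^+ 2 *: E2) (e ^+ 2 *: E3))) s & `|s - r| < eta.
Proof.
move=> B0 r0 eta eta0.
(* The same matrix at the point [r], reordered as a quadratic polynomial in [e], so that the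
   dependence on [e] is polynomial. *)
pose k := \det (quad_mx (r *: E2 + E3) (r *: E1) (r ^+ 2 *: B + r *: A0)).
have kE e : k.[e] = (\det (quad_mx B (A0 + e *: E1 + e ^+ 2 *: E2) (e ^+ 2 *: E3))).[r].
  rewrite !horner_det_quad; congr (\det _); apply/matrixP => a b; rewrite !mxE; ring.
have k0 : k.[0] = 0.
  rewrite horner_det_quad expr0n /= !scale0r !add0r.
  have -> : r ^+ 2 *: B + r *: A0 = r *: (r *: B + A0) by rewrite scalerDr scalerA.
  by rewrite detZ r0 mulr0.
have [K K0 HK] := poly_lipschitz_root _ _ _ k0.
have nB : 0 < `|\det B| * eta ^+ N.*2 by rewrite mulr_gt0 ?normr_gt0 ?exprn_gt0.
set b := `|\det B| * _ in nB.
have K1 : 0 < K + b + 1 by rewrite ltr_wpDl // addr_ge0 // ltW.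
exists (b / (K + b + 1)); first by rewrite divr_gt0.
move=> e e0 elt; set h := \det _.
have [sh lh] : size h = N.*2.+1 /\ lead_coef h = \det B by exact: size_det_quad.
have elt2 : e * (K + b + 1) < b by rewrite -ltr_pdivlMr.
have e1 : e <= 1.
  rewrite -(ler_pM2r K1) mul1r (le_trans (ltW elt2)) // -[X in X <= _]addr0.
  by rewrite [K + b]addrC -addrA lerD2l addr_ge0.
have hr : `|h.[r]| < b.
  rewrite -kE; apply: le_lt_trans (HK e _) _; rewrite subr0 (gtr0_norm e0) //.
  apply: le_lt_trans elt2; rewrite mulrC ler_wpM2l ?(ltW e0) //.
  by rewrite -addrA lerDl addr_ge0 // ltW.
have [rs hE] := closed_field_poly_normal h.
have srs : size rs = N.*2.
  have : size h = (size rs).+1.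
    by rewrite hE size_scale ?size_prod_XsubC // lh.
  by rewrite sh => -[].
case: (boolP (has (fun s => `|s - r| < eta) rs)) => [/hasP[s srs' sr]|/hasPn nh].
  exists s => //; rewrite hE rootZ ?lh // root_prod_XsubC //.
suff : b <= `|h.[r]| by move=> le; have := le_lt_trans le hr; rewrite ltxx.
rewrite hE hornerZ lh normrM /b ler_wpM2l // horner_prod normr_prod -srs.
have {}nh s : s \in rs -> eta <= `|r - s|.
  by move=> /nh; rewrite distrC -real_leNgt // ?normr_real // gtr0_real.
elim: rs nh {hE srs} => [|s rs IH] nh; first by rewrite big_nil.
rewrite big_cons exprS hornerXsubC ler_pM ?(ltW eta0) ?exprn_ge0 ?nh ?mem_head //; first by rewrite ltW.
by apply: IH => x xr; apply: nh; rewrite inE xr orbT.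
Qed.
End QuadDet.

Lemma finite_small (C : numFieldType) (I : finType) (P : I -> C -> Prop) :
  (forall i, exists2 delta, 0 < delta & forall e, 0 < e -> e < delta -> P i e) ->
  exists2 delta, 0 < delta & forall e, 0 < e -> e < delta -> forall i, P i e.
Proof.
move=> H; suff [delta d0 Hd] : exists2 delta, 0 < delta & forall e, 0 < e -> e < delta ->
    forall i, i \in enum I -> P i e.
  by exists delta => // e e0 ed i; apply: Hd; rewrite ?mem_enum.
elim: (enum I) => [|i r [d1 d10 H1]]; first by exists 1.
have [d2 d20 H2] := H i; have d0 : 0 < d1 + d2 by rewrite addr_gt0.
(* The order of the field may be partial, so [d1 d2 / (d1 + d2)] plays the part of a minimum. *)
have lt1 : d1 * d2 / (d1 + d2) < d1 by rewrite ltr_pdivrMr // ltr_pM2l // ltrDr.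
have lt2 : d1 * d2 / (d1 + d2) < d2 by rewrite ltr_pdivrMr // mulrC ltr_pM2l // ltrDl.
exists (d1 * d2 / (d1 + d2)); first by rewrite divr_gt0 // mulr_gt0.
move=> e e0 ed k; rewrite inE => /orP[/eqP ->|kr].
  by apply: H2 => //; apply: lt_trans lt2.
by apply: H1 => //; apply: lt_trans lt1.
Qed.

Lemma exists_nonroot (C : numFieldType) (p : {poly C}) : p != 0 -> exists x, p.[x] != 0.
Proof.
move=> p0; pose rs := [seq i%:R : C | i <- iota 0 (size p)].
have : ~~ all (root p) rs.
  apply/negP => h; have u : uniq rs.
    by rewrite map_inj_uniq ?iota_uniq // => a b /eqP; rewrite eqr_nat => /eqP.
  by have := max_poly_roots p0 h u; rewrite size_map size_iota ltnn.
by move/allPn => [x _ rx]; exists x.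
Qed.

Lemma unity_roots (C : numClosedFieldType) (n : nat) : (0 < n)%N ->
  exists rs : seq C, [/\ size rs = n, uniq rs & forall x, x \in rs -> x ^+ n = 1].
Proof.
move=> n0; have [rs E] := closed_field_poly_normal ('X^n - 1 : {poly C}).
have m1 : lead_coef ('X^n - 1 : {poly C}) = 1.
  by apply/eqP; rewrite -[_ == _]/(_ \is monic) -['X^n - 1]/('X^n - 1%:P) monicXnsubC.
rewrite m1 scale1r in E; exists rs; split.
- have : size ('X^n - 1 : {poly C}) = n.+1 by rewrite -['X^n - 1]/('X^n - 1%:P) size_XnsubC.
  by rewrite E size_prod_XsubC => -[].
- by rewrite -separable_prod_XsubC -E separable_Xn_sub_1 // pnatr_eq0 -lt0n.
- move=> x xr; have : root ('X^n - 1) x by rewrite E root_prod_XsubC.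
  by rewrite rootE !hornerE subr_eq0 => /eqP.
Qed.

(** By Bezout, the exponents [n] with [z ^ n = 1] are closed under gcd. *)
Lemma expr_gcd_eq1 (C : fieldType) (z : C) d (q : 'I_d -> nat) :
  (forall j, z ^+ q j = 1) -> \big[gcdn/0%N]_(j < d) q j = 1%N -> z = 1.
Proof.
move=> Hz g1; rewrite -[z]expr1 -g1.
apply: (big_ind (fun n => z ^+ n = 1)) => // m n zm zn.
case: (posnP m) => [->|m0]; first by rewrite gcd0n.
have [a b E _] := egcdnP n m0.
have := congr1 (fun k => z ^+ k) E; rewrite exprD mulnC exprM zm expr1n mulnC exprM zn expr1n mul1r.
by move=> <-.
Qed.

(** * Cyclic shifts of the cell and their characters *)

Section Shifts.
Variables (d : nat) (q : 'I_d -> nat).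

Definition shift_cell (b : bool) (j : 'I_d) (n : cell q) : cell q :=
  [ffun i => if i == j then (if b then ordS (n i) else ord_pred (n i)) else n i].

Lemma shift_cellK b j : cancel (shift_cell b j) (shift_cell (~~ b) j).
Proof.
move=> n; apply/ffunP => i; rewrite !ffunE; case: eqP => // _.
by case: b; rewrite /= ?ordSK ?ord_predK.
Qed.

Section ShiftMx.
Variable C : comUnitRingType.
Local Notation N := #|cell q|.

Definition shift_mx (b : bool) (j : 'I_d) : 'M[C]_N :=
  \matrix_(a, c) (enum_val c == shift_cell b j (enum_val a))%:R.

Lemma shift_mx_col b j (f : cell q -> C) :
  shift_mx b j *m (\col_a f (enum_val a)) = \col_a f (shift_cell b j (enum_val a)).
Proof.
apply/colP => a; rewrite !mxE (bigD1 (enum_rank (shift_cell b j (enum_val a)))) //=.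
rewrite !mxE enum_rankK eqxx mul1r big1 ?addr0 // => c cn; rewrite !mxE.
case: eqP => [E|]; last by rewrite mul0r.
by move: cn; rewrite -E enum_valK eqxx.
Qed.

Lemma shift_mx_mul b j : shift_mx b j *m shift_mx (~~ b) j = 1%:M.
Proof.
apply/matrixP => a c; have := shift_mx_col b j (fun n => (enum_val c == shift_cell (~~ b) j n)%:R).
move/colP/(_ a); rewrite [RHS]mxE => E; rewrite [RHS]mxE.
have -> : (a == c)%:R = (enum_val c == shift_cell (~~ b) j (shift_cell b j (enum_val a)))%:R :> C.
  by rewrite shift_cellK (inj_eq enum_val_inj) eq_sym.
by rewrite -E !mxE; apply: eq_bigr => k _; rewrite !mxE.
Qed.

Lemma det_shift_mx_unit b j : \det (shift_mx b j) \is a GRing.unit.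
Proof. by rewrite -unitmxE; have [] := mulmx1_unit (shift_mx_mul b j). Qed.

Lemma tr_shift_mx b j : (shift_mx b j)^T = shift_mx (~~ b) j.
Proof.
apply/matrixP => a c; rewrite !mxE; congr (nat_of_bool _)%:R; apply/idP/idP => /eqP ->.
  by rewrite shift_cellK.
by rewrite -{1}[b]negbK shift_cellK.
Qed.

(** The characters of the product of the groups [Z/q_i] are common eigenvectors of all the
    shifts. *)
Lemma shift_mx_char b j (rho : 'I_d -> C) : (forall i, rho i ^+ q i = 1) ->
  (forall i, rho i \is a GRing.unit) ->
  let v := \col_a \prod_i rho i ^+ (enum_val a : cell q) i in
  shift_mx b j *m v = (if b then rho j else (rho j)^-1) *: v.
Proof.
move=> rho1 ru v; rewrite /v (shift_mx_col b j (fun n => \prod_i rho i ^+ n i)).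
apply/colP => a; rewrite !mxE; move: (enum_val a) => n.
rewrite (bigD1 j) //= [in RHS](bigD1 j) //= mulrA; congr (_ * _); last first.
  by apply: eq_bigr => i ij; rewrite ffunE (negbTE ij).
rewrite ffunE eqxx; have := ltn_ord (n j); case: b => /= nq.
  rewrite -exprS; have [->|E] := eqVneq (n j).+1 (q j); first by rewrite modnn rho1 expr0.
  by rewrite modn_small // ltn_neqAle E.
case: (posnP (n j)) => [n0|n1].
  have qj0 : (0 < q j)%N by rewrite (leq_ltn_trans _ nq).
  rewrite n0 add0n modn_small; last by rewrite prednK.
  by apply: (mulrI (ru j)); rewrite mulrA divrr // mul1r expr0 -exprS prednK ?rho1.
rewrite -[in X in rho j ^+ (X %% _)](prednK n1) addSn /= modnDr modn_small; last by lia.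
by rewrite -[in RHS](prednK n1) exprS mulKr.
Qed.
End ShiftMx.
End Shifts.

Lemma pos_lower_bound (C : numFieldType) (a b : C) : 0 < a -> 0 < b ->
  exists c, [/\ 0 < c, c < a & c < b].
Proof.
move=> a0 b0; have d0 : 0 < a + b by rewrite addr_gt0.
exists (a * b / (a + b)); split; first by rewrite divr_gt0 // mulr_gt0.
- by rewrite ltr_pdivrMr // ltr_pM2l // ltrDr.
- by rewrite ltr_pdivrMr // mulrC ltr_pM2l // ltrDl.
Qed.

(** With [w_i = c_i / e], the substitution [x = u / e] followed by multiplication by [- e^2] makes
    the fibre matrix regular at [e = 0]. The next lemma does the same for [x = e / u], which covers
    the small roots. *)
Lemma quad_scale_large (C : fieldType) n (X1 X2 X3 X4 X5 : 'M[C]_n) (e u : C) : e != 0 ->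
  u ^+ 2 *: X4 + u *: (X1 + e *: - X3 + e ^+ 2 *: X2) + e ^+ 2 *: X5 =
  - e ^+ 2 *: ((u / e) ^+ 2 *: - X4 + (u / e) *: (X3 - (e^-1 *: X1 + e *: X2)) + - X5).
Proof. by move=> en; apply/matrixP => k l; rewrite !mxE; field. Qed.

Lemma quad_scale_small (C : fieldType) n (X1 X2 X3 X4 X5 : 'M[C]_n) (e u : C) : e != 0 -> u != 0 ->
  u ^+ 2 *: X5 + u *: (X1 + e *: - X3 + e ^+ 2 *: X2) + e ^+ 2 *: X4 =
  - u ^+ 2 *: ((e / u) ^+ 2 *: - X4 + (e / u) *: (X3 - (e^-1 *: X1 + e *: X2)) + - X5).
Proof. by move=> en un; apply/matrixP => k l; rewrite !mxE; field; rewrite en un. Qed.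

Section GenericFibre.
Variables (C : numClosedFieldType) (d : nat) (q : 'I_d -> nat) (j : 'I_d).
Local Notation N := #|cell q|.
Local Notation S b i := (shift_mx d q C b i).

(* [fibre_poly v w] evaluates at [x] to [x ^+ N] times the determinant of the
   shifted operator whose [j]-th Floquet multiplier is [x ^+ q j]. *)
Definition fibre_mid (v : 'rV[C]_N) (w : 'I_d -> C) : 'M[C]_N :=
  diag_mx v - \sum_(i | i != j) (w i *: S true i + (w i)^-1 *: S false i).

Definition fibre_poly (v : 'rV[C]_N) (w : 'I_d -> C) : {poly C} :=
  \det (quad_mx C N (- S true j) (fibre_mid v w) (- S false j)).

Lemma det_shift_neq0 b i : \det (S b i) != 0.
Proof. by have := det_shift_mx_unit d q C b i; rewrite unitfE. Qed.

Lemma size_fibre_poly v w : size (fibre_poly v w) = N.*2.+1.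
Proof.
have [] // := size_det_quad C N (- S true j) (fibre_mid v w) (- S false j).
by rewrite -scaleN1r detZ mulf_neq0 ?det_shift_neq0 // expf_neq0 // oppr_eq0 oner_eq0.
Qed.

Hypothesis q_gt0 : forall i, (0 < q i)%N.
Hypothesis q_gcd : \big[gcdn/0%N]_(i < d) q i = 1%N.
Hypothesis d_gt1 : exists i0 : 'I_d, i0 != j.

(* With [c_i = x ^ i], the limit root attached to the character [rho] is [- (limit_poly rho).[x]]. *)
Definition limit_poly (rho : 'I_d -> C) : {poly C} :=
  \sum_(i < d) (if i != j then rho i / rho j else 0) *: 'X^i.

Lemma limit_poly_coef rho (i : 'I_d) : i != j -> (limit_poly rho)`_i = rho i / rho j.
Proof.
move=> ij; rewrite coef_sum (bigD1 i) //= coefZ coefXn eqxx mulr1 ij big1 ?addr0 // => k ki.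
by rewrite coefZ coefXn [_ == nat_of_ord k]eq_sym -[_ == nat_of_ord i]/(k == i) (negbTE ki) mulr0.
Qed.

(** A cell selects one [q_i]-th root of unity for each [i]. Equal limit polynomials force
    [rho a i / rho b i] to be independent of [i]; this ratio is killed by every [q i], so it is 1.
    Nonvanishing uses an index other than [j]. *)
Lemma characters : exists rho : cell q -> 'I_d -> C,
  [/\ forall a i, rho a i ^+ q i = 1 &
      forall a b, a != b -> limit_poly (rho a) != limit_poly (rho b)] /\
  forall a, limit_poly (rho a) != 0.
Proof.
have /choice [us Hus] : forall i : 'I_d, exists rs : seq C, [/\ size rs = q i, uniq rs & forall x, x \in rs -> x ^+ q i = 1].
  by move=> i; apply: unity_roots.
pose rho (a : cell q) i := nth 0 (us i) (a i).
have rho1 a i : rho a i ^+ q i = 1.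
  by have [su _ H] := Hus i; apply: H; rewrite mem_nth ?su.
have rho0 a i : rho a i != 0.
  by apply: contra_eq_neq (rho1 a i) => ->; rewrite expr0n gtn_eqF ?q_gt0 // eq_sym oner_eq0.
exists rho; split; first split=> //.
- move=> a b; apply: contra_neq => E.
  have Ei i : i != j -> rho a i / rho a j = rho b i / rho b j.
    by move=> ij; rewrite -!limit_poly_coef // E.
  have z1 : rho a j / rho b j = 1.
    apply: expr_gcd_eq1 q_gcd => i; have [->|ij] := eqVneq i j.
      by rewrite exprMn exprVn !rho1 invr1 mulr1.
    have -> : rho a j / rho b j = rho a i / rho b i.
      have -> : rho a i = rho b i / rho b j * rho a j by rewrite -(Ei _ ij) divfK.
      by field; rewrite !rho0.
    by rewrite exprMn exprVn !rho1 invr1 mulr1.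
  have ej : rho a j = rho b j by rewrite -[LHS](divfK (rho0 b j)) z1 mul1r.
  have ei i : rho a i = rho b i.
    have [->//|ij] := eqVneq i j; have := Ei _ ij; rewrite ej.
    by apply: mulIf; rewrite invr_eq0.
  apply/ffunP => i; apply: val_inj; have [su uu _] := Hus i.
  by apply/eqP; rewrite -(nth_uniq 0 _ _ uu) ?su ?ltn_ord //; apply/eqP; exact: ei.
- move=> a; have [i0 ij] := d_gt1; apply: contraTneq isT => E.
  have := limit_poly_coef (rho a) i0 ij; rewrite E coef0 => /esym/eqP.
  by rewrite mulf_eq0 invr_eq0 !(negbTE (rho0 _ _)).
Qed.

(** A character is a common eigenvector, and its two eigenvalue contributions
    [- (sum x^i rho_i / rho_j) rho_j] and [sum x^i rho_i] cancel. *)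
Lemma fibre_limit_kernel (x : C) (rho : 'I_d -> C) b : (forall i, rho i ^+ q i = 1) -> (0 < N)%N ->
  \det (- (limit_poly rho).[x] *: S b j + \sum_(i | i != j) x ^+ i *: S true i) = 0.
Proof.
move=> rho1 N0.
have rho0 i : rho i != 0.
  by apply: contra_eq_neq (rho1 i) => ->; rewrite expr0n gtn_eqF ?q_gt0 // eq_sym oner_eq0.
(* For the backward shift the [j]-th component is inverted, so that the eigenvalue along [j] is
   [rho j] for both values of [b]. *)
pose sg i := if i == j then (if b then rho i else (rho i)^-1) else rho i.
have sg1 i : sg i ^+ q i = 1.
  by rewrite /sg; case: eqP => // _; case: (b); rewrite // exprVn rho1 invr1.
have sg0 i : sg i != 0.
  by rewrite /sg; case: (i =P j) => _; [case: (b)|]; rewrite ?invr_eq0 rho0.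
have sgu i : sg i \is a GRing.unit by rewrite unitfE.
pose v : 'cV[C]_N := \col_a \prod_i sg i ^+ (enum_val a : cell q) i.
have Sv c i : S c i *m v = (if c then sg i else (sg i)^-1) *: v by exact: shift_mx_char.
rewrite -det_tr; apply/eqP/det0P; exists v^T.
  apply/eqP => /rowP/(_ (Ordinal N0)); rewrite !mxE; apply/eqP/prodf_neq0 => i _.
  by rewrite expf_neq0.
rewrite -trmx_mul; apply: (canLR (@trmxK _ _ _)); rewrite trmx0 mulmxDl -scalemxAl Sv.
rewrite mulmx_suml (eq_bigr (fun i : 'I_d => (x ^+ i * rho i) *: v)) => [|i ij]; last first.
  by rewrite -scalemxAl Sv scalerA /sg (negbTE ij).
rewrite -scaler_suml scalerA -scalerDl.
have -> : (if b then sg j else (sg j)^-1) = rho j.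
  by rewrite /sg eqxx; case: (b) => //; rewrite invrK.
rewrite horner_sum mulNr mulr_suml [X in _ + X]big_mkcond addrC -sumrB big1 ?scale0r // => i _.
rewrite hornerZ hornerXn; case: ifP => _; last by rewrite !mul0r subrr.
by rewrite mulrAC divfK // mulrC subrr.
Qed.

Lemma generic_separable v : exists2 w : 'I_d -> C, (forall i, w i != 0) & separable_poly (fibre_poly v w).
Proof.
case: (posnP N) => [N0|N0].
  exists (fun=> 1) => [i|]; first exact: oner_neq0.
  have : size (fibre_poly v (fun=> 1)) = 1%N by rewrite size_fibre_poly N0.
  move/eqP/size_poly1P => [c c0 ->]; rewrite unlock derivC coprimep0.
  by rewrite -size_poly_eq1 size_polyC c0.
have [rho [[rho1 rhoD] rhoN]] := characters.
(* A generic [x]: it is nonzero, and the limit roots are nonzero and pairwise distinct. *)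
have [x xP] : exists x : C, ('X * (\prod_a limit_poly (rho a)) *
    \prod_(ab : cell q * cell q | ab.1 != ab.2) (limit_poly (rho ab.1) - limit_poly (rho ab.2))).[x] != 0.
  apply: exists_nonroot; rewrite !mulf_neq0 ?polyX_eq0 //.
    by apply/prodf_neq0 => a _.
  by apply/prodf_neq0 => ab abn; rewrite subr_eq0 rhoD.
move: xP; rewrite !hornerM hornerX !horner_prod !mulf_eq0 !negb_or => /andP[/andP[x0 xN] xD].
pose r a := - (limit_poly (rho a)).[x].
have r0 a : r a != 0 by move/prodf_neq0: xN => /(_ a isT); rewrite oppr_eq0.
have rD a b : a != b -> r a - r b != 0.
  move=> ab; move/prodf_neq0: xD => /(_ (a, b) ab) /=.
  by rewrite hornerD hornerN /r -opprD oppr_eq0.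
pose A0 : 'M[C]_N := \sum_(i | i != j) x ^+ i *: S true i.
pose E2 : 'M[C]_N := \sum_(i | i != j) (x ^+ i)^-1 *: S false i.
(* With the factor 2, open discs of radius [eta] around the limit roots are disjoint and remain at
   distance at least [eta] from 0. *)
pose gap (ab : cell q * cell q) eta :=
  2 * eta <= `|r ab.1| /\ (ab.1 != ab.2 -> 2 * eta <= `|r ab.1 - r ab.2|).
have gapP ab : exists2 delta, 0 < delta & forall e, 0 < e -> e < delta -> gap ab e.
  rewrite /gap; case: ab => a b /=; have ra0 : 0 < `|r a| / 2 by rewrite divr_gt0 ?normr_gt0.
  have half (t u : C) : t < u / 2 -> 2 * t <= u.
    by move=> tu; rewrite mulrC -ler_pdivlMr // ltW.
  case: (eqVneq a b) => [->|ab].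
    by exists (`|r b| / 2); rewrite ?divr_gt0 ?normr_gt0 // => e _ eb; split=> //; apply: half.
  have rab0 : 0 < `|r a - r b| / 2 by rewrite divr_gt0 ?normr_gt0 ?rD.
  have [c [c0 c1 c2]] := pos_lower_bound _ _ _ ra0 rab0.
  exists c => // e e0 ec; split=> [|_]; apply: half; exact: lt_trans ec _.
have [eta0 eta00 Heta] := finite_small C _ gap gapP.
have [eta [etagt0 eta1 eta2]] : exists eta, [/\ 0 < eta, forall a, 2 * eta <= `|r a| &
    forall a b, a != b -> 2 * eta <= `|r a - r b|].
  have lt : eta0 / 2 < eta0 by rewrite ltr_pdivrMr // ltr_pMr // ltr1n.
  have gt : 0 < eta0 / 2 by rewrite divr_gt0.
  exists (eta0 / 2); split=> // [a|a b ab].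
    by have [] := Heta _ gt lt (a, a).
  by have [_] := Heta _ gt lt (a, b); apply.
(* The boolean selects the family: [true] for the roots [s / e] near [r / e], and [false], with the
   shifts along [j] exchanged, for the roots [e / s] near [e / r]. *)
have [delta delta0 Hdelta] := finite_small C (bool * cell q)%type (fun ba e =>
   exists2 s, root (\det (quad_mx C N (S ba.1 j) (A0 + e *: (- diag_mx v) + e ^+ 2 *: E2) (e ^+ 2 *: S (~~ ba.1) j))) s
      & `|s - r ba.2| < eta) (fun ba => quad_root_near C N _ _ _ _ _ _ (det_shift_neq0 _ _)
        (fibre_limit_kernel x _ ba.1 (rho1 ba.2) N0) eta etagt0).
have [e [e0 ed ee]] : exists e, [/\ 0 < e, e < delta & e < eta].
  exact: pos_lower_bound.
have Hex ba := let: ex_intro2 z z1 z2 := Hdelta e e0 ed ba in ex_intro (fun z => _ /\ _) z (conj z1 z2).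
have [s Hs] := choice Hex.
have en : e != 0 by rewrite gt_eqF.
have s_root ba : root (\det (quad_mx C N (S ba.1 j) (A0 + e *: (- diag_mx v) + e ^+ 2 *: E2) (e ^+ 2 *: S (~~ ba.1) j))) (s ba).
  by have [] := Hs ba.
have s_near ba : `|s ba - r ba.2| < eta by have [] := Hs ba.
have s_big ba : eta < `|s ba|.
  have : 2 * eta < `|s ba| + eta.
    apply: le_lt_trans (eta1 ba.2) _; rewrite -[r ba.2](subrK (s ba)) addrC.
    by apply: le_lt_trans (ler_normD _ _) _; rewrite ltrD2l distrC.
  by rewrite mulr_natl mulr2n ltrD2r.
have s0 ba : s ba != 0 by rewrite -normr_gt0 (lt_trans etagt0).
have s_inj b a a' : a != a' -> s (b, a) != s (b, a').
  move=> aa; apply: contraTneq (eta2 _ _ aa) => E.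
  have lt : `|r a - r a'| < 2 * eta.
    have h1 := s_near (b, a); have h2 := s_near (b, a').
    rewrite /= distrC in h1; rewrite /= -E in h2.
    rewrite -[r a](subrK (s (b, a))) -addrA (le_lt_trans (ler_normD _ _)) //.
    by rewrite mulr_natl mulr2n ltrD.
  by apply/negP => le; have := lt_le_trans lt le; rewrite ltxx.
(* The scaling [c_i / e] with [c_i = x^i]; the value at [j] is a nonzero default. *)
pose w i : C := if i == j then 1 else x ^+ i / e.
exists w => [i|].
  by rewrite /w; case: (i =P j) => _; rewrite ?oner_neq0 // mulf_neq0 ?invr_eq0 // expf_neq0.
have midE : fibre_mid v w = diag_mx v - (e^-1 *: A0 + e *: E2).
  rewrite /fibre_mid; congr (_ - _); rewrite !scaler_sumr -big_split /=; apply: eq_bigr => i ij.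
  by rewrite /w (negbTE ij) !scalerA invfM invrK mulrC [_^-1 * e]mulrC.
have [cs csN csu] : exists2 cs : seq (cell q), size cs = N & uniq cs.
  by exists (enum (cell q)); rewrite ?enum_uniq // -cardE.
pose rs := [seq s (true, a) / e | a <- cs] ++ [seq e / s (false, a) | a <- cs].
have rsN : size rs = N.*2 by rewrite size_cat !size_map csN addnn.
have rs_root : all (root (fibre_poly v w)) rs.
  apply/allP => y; rewrite mem_cat => /orP[] /mapP[a _ ->]; rewrite rootE horner_det_quad midE.
  - have := s_root (true, a); rewrite rootE horner_det_quad /= (quad_scale_large _ _ _ _ _ _ _ _ _ en).
    by rewrite detZ mulf_eq0 expf_eq0 oppr_eq0 expf_eq0 (negbTE en) !andbF.
  - have := s_root (false, a); rewrite rootE horner_det_quad /= (quad_scale_small _ _ _ _ _ _ _ _ _ en (s0 _)).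
    by rewrite detZ mulf_eq0 expf_eq0 oppr_eq0 expf_eq0 (negbTE (s0 _)) !andbF.
have rs_uniq : uniq rs.
  rewrite cat_uniq; apply/and3P; split.
  - rewrite map_inj_uniq // => a a' /eqP; rewrite (inj_eq (mulIf _)) ?invr_eq0 // => E.
    by apply/eqP; apply: contraTT E => /s_inj.
  (* Since [|s| > eta > e], roots of the first family have modulus above 1 and those of the second
     below 1. *)
  - apply/hasPn => y /mapP[a _ ->]; apply/mapP => -[a' _ E].
    have : s (true, a') * s (false, a) = e * e.
      by rewrite -[s (true, a')](divfK en) -E mulrAC divfK // s0.
    move/(congr1 (fun z => `|z|)); rewrite !normrM (gtr0_norm e0) => E'.
    have : e * e < `|s (true, a')| * `|s (false, a)|.
      by rewrite ltr_pM ?(ltW e0) // (lt_trans ee).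
    by rewrite E' ltxx.
  - rewrite map_inj_uniq // => a a' /eqP; rewrite (inj_eq (mulfI en)) (inj_eq invr_inj) => E.
    by apply/eqP; apply: contraTT E => /s_inj.
(* These are [2 N] distinct roots of a polynomial of degree [2 N], hence all of them, each
   simple. *)
have := all_roots_prod_XsubC _ rs_root; rewrite size_fibre_poly rsN => /(_ erefl).
rewrite uniq_rootsE => /(_ rs_uniq) ->.
have l0 : lead_coef (fibre_poly v w) != 0.
  by rewrite lead_coef_eq0 -size_poly_eq0 size_fibre_poly.
by rewrite (eqp_separable (eqp_scale _ l0)) separable_prod_XsubC.
Qed.
End GenericFibre.

(** * The Floquet matrix *)

(** This and the next three lemmas translate the integer wrap-around tests of [nbr_coef] into the
    modular arithmetic of [ordS] and [ord_pred]. *)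
Lemma wrap_succ (n Q : nat) : (n < Q)%N ->
  (if n%:Z + 1 == Q%:Z then 0 else if n%:Z + 1 == -1 then Q%:Z - 1 else n%:Z + 1) = (n.+1 %% Q)%N%:Z.
Proof.
move=> nQ; have [E|E] := eqVneq n.+1 Q.
  by rewrite -E modnn; case: eqP => // h; exfalso; lia.
rewrite modn_small; last by rewrite ltn_neqAle E.
case: eqP => [h|_]; first by exfalso; lia.
by case: eqP => h; lia.
Qed.

Lemma wrap_pred (n Q : nat) : (n < Q)%N ->
  (if n%:Z + -1 == Q%:Z then 0 else if n%:Z + -1 == -1 then Q%:Z - 1 else n%:Z + -1) =
  ((n + Q).-1 %% Q)%N%:Z.
Proof.
move=> nQ; case: eqP => [h|_]; first by exfalso; lia.
have [E|E] := posnP n.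
  by rewrite E /= modn_small; lia.
have -> : (n + Q).-1 = (n.-1 + Q)%N by lia.
rewrite modnDr modn_small; last by lia.
by case: eqP => h; lia.
Qed.

Lemma phase_succ (T : Type) (x y z : T) (n Q : nat) : (n < Q)%N ->
  (if n%:Z + 1 == Q%:Z then x else if n%:Z + 1 == -1 then y else z) = if n.+1 == Q then x else z.
Proof.
move=> nQ; have -> : (n%:Z + 1 == Q%:Z) = (n.+1 == Q) by rewrite -addn1 -eqz_nat PoszD.
by case: ifP => // _; case: eqP => // h; exfalso; lia.
Qed.

Lemma phase_pred (T : Type) (x y z : T) (n Q : nat) : (n < Q)%N ->
  (if n%:Z + -1 == Q%:Z then x else if n%:Z + -1 == -1 then y else z) = if n == 0%N then y else z.
Proof.
move=> nQ; case: eqP => [h|_]; first by exfalso; lia.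
by have -> : (n%:Z + -1 == -1) = (n == 0%N) by case: eqP; case: eqP => //; lia.
Qed.

Section FloquetMx.
Variables (d : nat) (q : 'I_d -> nat).
Local Notation N := #|cell q|.

(** The Floquet phase is distributed evenly over the [q_i] steps of a period, instead of sitting on
    the edge of the cell as in [Dmat]. *)
Definition floquet_mx (C : numClosedFieldType) (v : 'rV[C]_N) (w : 'I_d -> C) : 'M[C]_N :=
  diag_mx v - \sum_i (w i *: shift_mx d q C true i + (w i)^-1 *: shift_mx d q C false i).

Section Generic.
Variable C : numClosedFieldType.
Local Notation S b i := (shift_mx d q C b i).

Lemma fibre_poly_horner (j : 'I_d) (v : 'rV[C]_N) (w : 'I_d -> C) x : x != 0 ->
  (fibre_poly C d q j v w).[x] =
  \det (floquet_mx C v (fun i => if i == j then x else w i)) * x ^+ N.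
Proof.
move=> x0; rewrite horner_det_quad mulrC -detZ; congr (\det _).
rewrite /floquet_mx (bigD1 j) //= eqxx (eq_bigr (fun i => w i *: S true i + (w i)^-1 *: S false i)).
  rewrite /fibre_mid; move: (\sum_(i | i != j) _) (diag_mx v) (S true j) (S false j) => X1 X2 X3 X4.
  by apply/matrixP => k l; rewrite !mxE; field.
by move=> i ij; rewrite (negbTE ij).
Qed.

Lemma laurent_fibre_poly (j : 'I_d) (v : 'rV[C]_N) :
  laurent_poly C d j (fibre_poly C d q j v).
Proof.
apply: laurent_poly_det => a b.
have Lmid : laurent C d j (fun w => fibre_mid C d q j v w a b).
  have Lsum := laurent_sum C d j _ (index_enum 'I_d) (fun i => i != j)
    (fun i w => w i ^ 1 * S true i a b + w i ^ (-1) * S false i a b) _.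
  apply: laurent_ext (laurentD _ _ _ _ _ (laurent_cst _ _ _ (diag_mx v a b))
    (laurentM _ _ _ _ _ (laurent_cst _ _ _ (-1)) (Lsum _))) => [w _|i ij].
    rewrite /fibre_mid mxE; congr (_ + _); rewrite mxE summxE mulN1r; congr (- _).
    by apply: eq_bigr => i _; rewrite !mxE.
  by apply: laurentD; apply: laurentM (laurent_cst _ _ _ _); apply: laurent_expz.
move=> n; apply: (laurent_ext _ _ _ _ _ _ (laurent_polyD _ _ _ _ _ (laurent_polyD _ _ _ _ _
   (laurent_poly_cst _ _ _ ((- S true j) a b *: 'X^2))
   (laurent_polyM _ _ _ _ _ (laurent_polyC _ _ _ _ Lmid) (laurent_poly_cst _ _ _ 'X)))
   (laurent_poly_cst _ _ _ ((- S false j) a b)%:P) n)) => w _.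
by rewrite mxE mul_polyC.
Qed.

Lemma floquet_mx_shift (v : 'rV[C]_N) (c : C) w :
  floquet_mx C (v - const_mx c) w = floquet_mx C v w - c%:M.
Proof. by rewrite /floquet_mx raddfB /= diag_const_mx addrAC. Qed.

Lemma floquet_mx_herm (v : 'rV[C]_N) w : (forall a, v 0 a \is Num.real) -> (forall i, `|w i| = 1) ->
  map_mx Num.conj (floquet_mx C v w)^T = floquet_mx C v w.
Proof.
move=> vr w1; rewrite /floquet_mx raddfB /= map_mxB; congr (_ - _).
  apply/matrixP => a b; rewrite !mxE; case: (eqVneq b a) => [->|ba].
    by rewrite !mulr1n; apply/CrealP.
  by rewrite !mulr0n raddf0.
rewrite linear_sum raddf_sum; apply: eq_bigr => i _.
rewrite raddfD /= !linearZ /= !tr_shift_mx map_mxD !map_mxZ.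
have Sr b : map_mx Num.conj (S b i) = S b i.
  by apply/matrixP => a c; rewrite !mxE rmorph_nat.
by rewrite !Sr fmorphV /= (unit_conj _ _ (w1 i)) invrK addrC.
Qed.

Lemma floquet_mx_lipschitz (j : 'I_d) (v : 'rV[C]_N) (w : 'I_d -> C) z a b : `|w j| = 1 -> `|z| = 1 ->
  `|(floquet_mx C v (fun i => if i == j then w i * z else w i) - floquet_mx C v w) a b| <= 2 * `|z - 1|.
Proof.
move=> w1 z1.
have w0 : w j != 0 by rewrite -normr_eq0 w1 oner_eq0.
have z0 : z != 0 by rewrite -normr_eq0 z1 oner_eq0.
have -> : floquet_mx C v (fun i => if i == j then w i * z else w i) - floquet_mx C v w =
   - ((w j * (z - 1)) *: S true j + ((w j)^-1 * (z^-1 - 1)) *: S false j).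
  rewrite /floquet_mx (bigD1 j) //= eqxx [in X in _ - X](bigD1 j) //=.
  rewrite (eq_bigr (fun i => w i *: S true i + (w i)^-1 *: S false i)) => [|i ij]; last by rewrite (negbTE ij).
  move: (\sum_(i | i != j) _) (diag_mx v) (S true j) (S false j) => X1 X2 X3 X4.
  by apply/matrixP => k l; rewrite !mxE; field; rewrite w0 z0.
rewrite mxE normrN mxE; apply: le_trans (ler_normD _ _) _.
have zV : `|z^-1 - 1| = `|z - 1|.
  by rewrite -(unit_conj _ _ z1) -[RHS]norm_conjC rmorphB rmorph1.
rewrite mulr_natl mulr2n !mxE !normrM normrV ?unitfE // w1 invr1 !mul1r zV.
by rewrite lerD // ler_piMr // ?normr_ge0 // ger0_norm ?ler0n // lern1 leq_b1.
Qed.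

Lemma char_poly_conj n (A B L : 'M[C]_n) : L \in unitmx -> A *m L = L *m B -> char_poly A = char_poly B.
Proof.
move=> Lu AL; have Lu' : map_mx polyC L \in unitmx by rewrite map_unitmx.
have : char_poly_mx A *m map_mx polyC L = map_mx polyC L *m char_poly_mx B.
  by rewrite mulmxBl mulmxBr -!map_mxM AL scalar_mxC.
move/(congr1 determinant); rewrite !det_mulmx mulrC; apply: mulrI.
by rewrite -unitmxE.
Qed.
End Generic.

Section Dmat.
Variables (R : realType) (V : lattice d -> R).
Hypothesis q_gt0 : forall i, (0 < q i)%N.
Local Notation C := (R[i]).
Local Notation e := (@cexp2pi R).

Definition multiplier (k : 'rV[R]_d) (i : 'I_d) : C := e (k 0 i / (q i)%:R).
Definition potential : 'rV[C]_N := \row_a ((V (embed_cell (enum_val a : cell q)))%:C)%C.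

Lemma multiplierX k i : multiplier k i ^+ q i = e (k 0 i).
Proof.
by rewrite -cexpMn -[_ *+ q i]mulr_natr divfK // pnatr_eq0 -lt0n.
Qed.

Definition gauge (k : 'rV[R]_d) (n : cell q) : C := \prod_i multiplier k i ^+ n i.

(** Inside the cell the gauge changes by one factor [w_j]. Across the edge it jumps by the opposite
    of [q_j - 1] factors, and the Floquet phase [w_j ^ q_j] makes up the difference. *)
Lemma nbr_coef_gauge k (n n' : cell q) j b :
  nbr_coef k n n' j b * gauge k n' =
  gauge k n * ((if b then multiplier k j else (multiplier k j)^-1) * (n' == shift_cell d q b j n)%:R).
Proof.
set w := multiplier k.
have w0 i : w i != 0 by exact: cexp_neq0.
have nlt := ltn_ord (n j).
rewrite /nbr_coef; set c : int := _ + (if b then _ else _).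
set wr : int := if c == _ then 0 else _; set ph : C := if c == _ then _ else _.
have wrE : wr = (shift_cell d q b j n j : nat)%:Z.
  by rewrite /wr /c ffunE eqxx; case: (b) => /=; rewrite (wrap_succ, wrap_pred).
have -> : [forall i, (nat_of_ord (n' i))%:Z == (if i == j then wr else (nat_of_ord (n i))%:Z)] =
    (n' == shift_cell d q b j n).
  apply/forallP/eqP => [H|-> i].
    apply/ffunP => i; apply: val_inj; have := H i; case: (i =P j) => [->|/eqP ij].
      by rewrite wrE => /eqP [].
    by rewrite ffunE (negbTE ij) => /eqP [].
  case: (i =P j) => [->|/eqP ij]; first by rewrite wrE.
  by rewrite ffunE (negbTE ij).
case: eqP => [->|_]; last by rewrite mul0r !mulr0.
rewrite mulr1 /gauge (bigD1 j) //= [in RHS](bigD1 j) //=.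
rewrite (eq_bigr (fun i => w i ^+ n i)) => [|i ij]; last by rewrite ffunE (negbTE ij).
rewrite mulrA [RHS]mulrAC; congr (_ * _); rewrite -/(w j).
have wq : w j ^+ q j = e (k 0 j) by exact: multiplierX.
rewrite /ph /c ffunE eqxx; case: (b) => /=; rewrite (phase_succ, phase_pred) //.
  have [E|E] := eqVneq (n j).+1 (q j); first by rewrite E modnn expr0 mulr1 -wq -exprSr E.
  by rewrite modn_small ?mul1r ?exprSr // ltn_neqAle E.
have [E|E] := posnP (n j).
  rewrite E add0n modn_small ?prednK // expr0 mul1r cexpN -wq.
  have -> : w j ^+ q j = w j ^+ (q j).-1 * w j by rewrite -exprSr prednK.
  move: (w j ^+ (q j).-1) (expf_neq0 (q j).-1 (w0 j)) (w0 j) => W W0 wj0; by field; rewrite W0 wj0.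
have -> : (n j + q j).-1 = ((n j).-1 + q j)%N by lia.
rewrite modnDr modn_small; last by lia.
have -> : w j ^+ n j = w j ^+ (n j).-1 * w j by rewrite -exprSr prednK.
by rewrite mul1r mulfK.
Qed.

Lemma char_poly_Dmat k :
  char_poly (Dmat q V k) = char_poly (floquet_mx C potential (multiplier k)).
Proof.
pose L : 'M[C]_N := diag_mx (\row_a gauge k (enum_val a)).
apply: (@char_poly_conj _ _ _ _ L).
  rewrite unitmxE det_diag unitfE; apply/prodf_neq0 => a _; rewrite mxE.
  by apply/prodf_neq0 => i _; rewrite expf_neq0 // cexp_neq0.
rewrite mul_mx_diag mul_diag_mx; apply/matrixP => a b; rewrite !mxE summxE mulrBl mulrBr; congr (_ - _).
  rewrite (inj_eq enum_val_inj); case: eqP => [->|_]; first by rewrite mulr1n mulrC.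
  by rewrite mulr0n mul0r mulr0.
rewrite mulr_suml mulr_sumr; apply: eq_bigr => j _.
by rewrite mulrDl !nbr_coef_gauge -mulrDr !mxE.
Qed.
End Dmat.
End FloquetMx.

(** * Band functions and double roots over the level set *)

Section LevelSet.
Variables (R : realType) (d : nat) (q : 'I_d -> nat) (V : lattice d -> R).
Hypothesis q_gt0 : forall i, (0 < q i)%N.
Local Notation N := #|cell q|.
Local Notation C := (R[i]).
Local Notation e := (@cexp2pi R).

Lemma card_cell : N = (\prod_(j < d) q j)%N.
Proof.
rewrite card_dep_ffun foldrE big_map enumT; apply: eq_bigr => i _.
by rewrite card_ord.
Qed.

(** Periodicity in [k] turns an extremum over the unit box into one over the whole space. *)
Lemma Dmat_frac (k : 'rV[R]_d) :
  exists2 k' : 'rV[R]_d, unit_box R d k' & Dmat q V k' = Dmat q V k.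
Proof.
pose k' : 'rV[R]_d := \row_i (k 0 i - (Num.floor (k 0 i))%:~R).
have ek i : e (k' 0 i) = e (k 0 i).
  by rewrite mxE cexpD cexpN cexp_int invr1 mulr1.
exists k' => [i|].
  rewrite mxE subr_ge0 floor_le ltrBlDl /=.
  by have /andP[_] := floor_itv (k 0 i); rewrite intrD.
apply/matrixP => a b; rewrite !mxE; congr (_ - _); apply: eq_bigr => i _.
by rewrite /nbr_coef ek !cexpN ek.
Qed.

Lemma potential_real a : potential d q R V 0 a \is Num.real.
Proof. by rewrite mxE; apply/complex_realP; eexists. Qed.

(** A sorted real spectrum is determined by the characteristic polynomial, so the choice made by
    [xget] is immaterial. *)
Lemma band_spec m (k : 'rV[R]_d) s : sorted <=%R s ->
  char_poly (floquet_mx d q C (potential d q R V) (multiplier d q R k)) =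
    \prod_(x <- s) ('X - ((x%:C)%C)%:P) ->
  band q V m k = nth 0 s m.-1.
Proof.
rewrite -char_poly_Dmat // => so sE; rewrite /band.
have [] : eigen_spec q V k (xget [::] (eigen_spec q V k)) by apply: xgetPex; exists s.
set t := xget _ _ => to tE; congr (nth _ _ _).
apply: (sorted_eq le_trans le_anti) => //; apply: char_poly_uniq.
by rewrite -tE.
Qed.

Lemma cexp_dense (eps : C) : 0 < eps -> exists t : R, e t != 1 /\ `|e t - 1| < eps.
Proof.
move=> eps0; have [r rE] : exists r : R, eps = (r%:C)%C.
  by apply/complex_realP; rewrite gtr0_real.
have r0 : 0 < r by rewrite -ltcR -rE.
have r20 : 0 < r / 2 by rewrite divr_gt0.
have cosn : \forall t \near (0 : R), `|1 - cos t| < r / 2.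
  by have /cvgr_dist_lt := (@continuous_cos R 0); rewrite cos0; apply.
have sinn : \forall t \near (0 : R), `|0 - sin t| < r / 2.
  by have /cvgr_dist_lt := (@continuous_sin R 0); rewrite sin0; apply.
have [del /= del0 Hdel] := (nbhs_ballP _ _).1 (filterI cosn sinn).
(* Capping at 1 keeps [th] below [pi], so [sin th > 0] and the point differs from 1. *)
pose th := Num.min (del / 2) 1.
have th0 : 0 < th by rewrite lt_min ltr01 divr_gt0.
have thpi : th < pi.
  apply: (@le_lt_trans _ _ 1); first by rewrite ge_min lexx orbT.
  by apply: lt_le_trans (pi_ge2 R); rewrite ltr1n.
have thd : ball (0 : R) del th.
  rewrite /ball /= sub0r normrN gtr0_norm // (@le_lt_trans _ _ (del / 2)) //.
    by rewrite ge_min lexx.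
  by rewrite ltr_pdivrMr // ltr_pMr // ltr1n.
have [cs sn] := Hdel _ thd.
have p2 : (2 * pi : R) != 0 by rewrite mulf_neq0 // gt_eqF // pi_gt0.
exists (th / (2 * pi)); rewrite /cexp2pi mulrC divfK //; split.
  rewrite eq_complex /= negb_and; apply/orP; right.
  by rewrite gt_eqF // sin_gt0_pi // th0.
rewrite rE; apply: (@le_lt_trans _ _ (`|1 - cos th| + `|0 - sin th|)%:C%C); last first.
  by rewrite ltcR [r]splitr ltrD.
have -> : Complex (cos th) (sin th) - 1 = ((cos th - 1)%:C)%C + ((sin th)%:C)%C * 'i%C.
  by apply/eqP; rewrite eq_complex /=; apply/andP; split; apply/eqP; ring.
apply: le_trans (ler_normD _ _) _; rewrite normrM sub0r normrN.
have nr (x : R) : `|(x%:C)%C| = (`|x|%:C)%C by rewrite normc_def /= expr0n addr0 sqrtr_sqr.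
have -> : `|'i%C : C| = 1 by rewrite normc_def /= expr0n add0r expr1n sqrtr1.
by rewrite mulr1 !nr [`|1 - _|]distrC rmorphD.
Qed.

Lemma fibre_double_root (m : nat) (lam : R) (k : 'rV[R]_d) (j : 'I_d) :
  (1 <= m <= N)%N -> band q V m k = lam ->
  (forall k1 k2, 0 <= (band q V m k1 - lam) * (band q V m k2 - lam)) ->
  let p := fibre_poly C d q j (potential d q R V - const_mx (lam%:C)%C) (multiplier d q R k) in
  p.[multiplier d q R k j] = 0 /\ p^`().[multiplier d q R k j] = 0.
Proof.
move=> /andP[m1 mN] bk ext p; set w := multiplier d q R k in p *; set v := potential d q R V in p *.
have mN' : (m.-1 < N)%N by rewrite prednK.
have wu i : `|w i| = 1 by exact: cexp_norm.
pose A (z : C) := floquet_mx d q C v (fun i => if i == j then w i * z else w i).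
(* Moving [k_j] by [t q_j] multiplies [w_j] by [e t] and fixes the other multipliers. *)
pose kt (t : R) : 'rV[R]_d := \row_i (if i == j then k 0 i + t * (q i)%:R else k 0 i).
have AE t : A (e t) = floquet_mx d q C v (multiplier d q R (kt t)).
  rewrite /A; congr floquet_mx; apply/funext => i; rewrite /w /multiplier mxE.
  by case: eqP => // _; rewrite mulrDl mulfK ?cexpD // pnatr_eq0 -lt0n.
have A1 : A 1 = floquet_mx d q C v w.
  by rewrite /A; congr floquet_mx; apply/funext => i; rewrite mulr1 if_same.
have Aherm t : map_mx Num.conj (A (e t))^T = A (e t).
  by rewrite AE; apply: floquet_mx_herm => [a|i]; [exact: potential_real|exact: cexp_norm].
have [s0 [so0 sA0]] := herm_sorted_spectrum _ _ _ (Aherm 0).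
rewrite cexp0 in sA0.
have nthE t s : sorted <=%R s -> char_poly (A (e t)) = \prod_(x <- s) ('X - ((x%:C)%C)%:P) ->
    nth 0 s m.-1 = band q V m (kt t).
  rewrite AE => so sA; exact: (esym (band_spec m (kt t) s so sA)).
have Alip t a b : `|(A (e t) - A 1) a b| <= 2 * `|e t - 1|.
  by rewrite A1; apply: floquet_mx_lipschitz; rewrite ?wu ?cexp_norm.
have Adet t : \det (A (e t) - ((lam%:C)%C)%:M) * (w j * e t) ^+ N = p.[w j * e t].
  have nz : w j * e t != 0 by rewrite mulf_neq0 ?cexp_neq0.
  have E := fibre_poly_horner d q C j (v - const_mx (lam%:C)%C) w (w j * e t) nz.
  have Aw : A (e t) = floquet_mx d q C v (fun i => if i == j then w j * e t else w i).
    by rewrite /A; congr floquet_mx; apply/funext => i; case: eqP => [->|].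
  rewrite floquet_mx_shift -Aw in E; exact: (esym E).
have s0m : nth 0 s0 m.-1 = lam.
  have sA0' := sA0; rewrite A1 in sA0'; rewrite -bk; exact: (esym (band_spec m k s0 so0 sA0')).
have {}ext t1 t2 s t : sorted <=%R s -> char_poly (A (e t1)) = \prod_(x <- s) ('X - ((x%:C)%C)%:P) ->
    sorted <=%R t -> char_poly (A (e t2)) = \prod_(x <- t) ('X - ((x%:C)%C)%:P) ->
    0 <= (nth 0 s m.-1 - lam) * (nth 0 t m.-1 - lam).
  by move=> so sA to tA; rewrite (nthE _ _ so sA) (nthE _ _ to tA).
have wj1 := wu j; move: (w j) wj1 Adet => w0 wj1 Adet.
clearbody A p; clear AE A1 nthE.
have two : ((2 : R)%:C)%C = 2 by rewrite rmorph_nat.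
pose Z (z : C) := exists t, z = e t.
have Z1 : Z 1 by exists 0; rewrite cexp0.
have Zu z : Z z -> `|z| = 1 by move=> [t ->]; rewrite cexp_norm.
have Zc z : Z z -> Z (Num.conj z).
  by move=> [t ->]; exists (- t); rewrite (unit_conj _ _ (cexp_norm _ t)) cexpN.
have Zd eps : 0 < eps -> exists z, [/\ Z z, z != 1 & `|z - 1| < eps].
  by move=> /cexp_dense [t [t1 t2]]; exists (e t); split=> //; exists t.
have ZA z : Z z -> map_mx Num.conj (A z)^T = A z by move=> [t ->]; exact: Aherm.
have Zl z : Z z -> forall a b, `|(A z - A 1) a b| <= ((2 : R)%:C)%C * `|z - 1|.
  by move=> [t ->] a b; rewrite two; exact: Alip.
have Zp z : Z z -> \det (A z - ((lam%:C)%C)%:M) * (w0 * z) ^+ N = p.[w0 * z].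
  by move=> [t ->]; exact: Adet.
have Ze z1 z2 s t : Z z1 -> Z z2 -> sorted <=%R s -> char_poly (A z1) = \prod_(x <- s) ('X - ((x%:C)%C)%:P) ->
    sorted <=%R t -> char_poly (A z2) = \prod_(x <- t) ('X - ((x%:C)%C)%:P) ->
    0 <= (nth 0 s (Ordinal mN') - lam) * (nth 0 t (Ordinal mN') - lam).
  by move=> [t1 ->] [t2 ->]; exact: ext.
exact: (@extremal_double_root R N (Ordinal mN') Z A p w0 lam 2 s0 wj1 (ler0n R 2) Z1 Zu Zc Zd ZA Zl Zp so0 sA0 s0m Ze).
Qed.
End LevelSet.

(** * Patches of large dimension *)

Section ContinuityAt.
Variables (R : realType) (T : topologicalType) (x : T).

Lemma continuous_at_cst (f : T -> R) (c : R) : (forall y, f y = c) -> f @ x --> f x.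
Proof.
move=> fc; have -> : f = (fun=> c) by apply/funext.
exact: cvg_cst.
Qed.

Lemma continuous_at_coord n (f : T -> R) (g : T -> 'rV[R]_n) (b : 'I_n) :
  {for x, continuous g} -> (forall y, f y = g y 0 b) -> f @ x --> f x.
Proof.
move=> cg fg; have -> : f = (fun A : 'rV[R]_n => A 0 b) \o g by apply/funext.
apply: cvg_comp; first exact: cg.
exact: coord_continuous.
Qed.

Lemma continuous_at_sum I (r : seq I) (F : I -> T -> R) :
  (forall i, F i @ x --> F i x) -> (fun y => \sum_(i <- r) F i y) @ x --> \sum_(i <- r) F i x.
Proof.
move=> HF; elim: r => [|i r IH].
  by rewrite big_nil; under eq_fun do rewrite big_nil; exact: cvg_cst.
by rewrite big_cons; under eq_fun do rewrite big_cons; apply: cvgD.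
Qed.

Lemma continuous_at_prod I (r : seq I) (F : I -> T -> R) :
  (forall i, F i @ x --> F i x) -> (fun y => \prod_(i <- r) F i y) @ x --> \prod_(i <- r) F i x.
Proof.
move=> HF; elim: r => [|i r IH].
  by rewrite big_nil; under eq_fun do rewrite big_nil; exact: cvg_cst.
by rewrite big_cons; under eq_fun do rewrite big_cons; apply: cvgM.
Qed.

Lemma continuous_at_det n (M : T -> 'M[R]_n) :
  (forall a b, (fun y => M y a b) @ x --> M x a b) -> (fun y => \det (M y)) @ x --> \det (M x).
Proof.
move=> HM; apply: continuous_at_sum => s; apply: cvgM; first exact: cvg_cst.
by apply: continuous_at_prod => i.
Qed.

Lemma continuous_at_neq0 (f : T -> R) : f @ x --> f x -> f x != 0 -> \forall y \near x, f y != 0.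
Proof.
move=> /cvgr_dist_lt cf fx; have n0 : 0 < `|f x| by rewrite normr_gt0.
apply: filterS (cf _ n0) => y; apply: contraTneq => ->.
by rewrite subr0 ltxx.
Qed.
End ContinuityAt.

(* A kernel of dimension at most one lies off some coordinate hyperplane. *)
Lemma row_free_drop_column (F : fieldType) p d (J : 'M[F]_(p, d)) : (0 < d)%N ->
  (d <= p.+1)%N -> row_free J ->
  exists j : 'I_d, row_full (col_mx J (delta_mx 0 j : 'rV_d)).
Proof.
move=> d0 dp /eqP rJ; pose K := kermx J^T.
have rK : (\rank K <= 1)%N by rewrite mxrank_ker mxrank_tr rJ leq_subLR addn1.
suff [j Hj] : exists j : 'I_d, forall c : 'rV_d, (c <= K)%MS -> c 0 j = 0 -> c = 0.
  exists j; rewrite /row_full -mxrank_tr; apply/inj_row_free => c.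
  rewrite tr_col_mx mul_mx_row => /eqP; rewrite row_mx_eq0 => /andP[/eqP cJ /eqP cj].
  apply: Hj; first by apply/sub_kermxP.
  by move/rowP: cj => /(_ 0); rewrite trmx_delta -colE !mxE.
have [K0|Kn] := eqVneq K 0.
  by exists (Ordinal d0) => c; rewrite K0 submx0 => /eqP ->.
have c0 : nz_row K != 0 by rewrite nz_row_eq0.
have /existsP[j cj] : [exists j, nz_row K 0 j != 0].
  rewrite -negb_forall; apply: contraNN c0 => /forallP H.
  by apply/eqP/rowP => j; rewrite mxE; apply/eqP.
exists j => c cK c0j.
have Ksub : (K <= nz_row K)%MS.
  have := mxrank_leqif_eq (nz_row_sub K) => -[_ E].
  suff : (nz_row K == K)%MS by case/andP.
  by rewrite -E eqn_leq mxrankS ?nz_row_sub //= rank_rV c0.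
have /sub_rVP[a cE] := submx_trans cK Ksub.
move: c0j; rewrite cE mxE => /eqP; rewrite mulf_eq0 (negbTE cj) orbF => /eqP ->.
by rewrite scale0r.
Qed.

Section Patch.
Variables (R : realType) (p d : nat) (U : set 'rV[R]_p) (phi : 'rV[R]_p -> 'rV[R]_d).
Hypothesis U_open : open U.
Hypothesis phi_diff : forall x, U x -> differentiable phi x.
Hypothesis phi_C1 : forall (v : 'rV[R]_p) x, U x -> {for x, continuous (fun y => 'D_v phi y)}.

(** The same [j] must serve on a whole neighbourhood. Directions that are exact at [x0] remain
    independent modulo the coordinate [j] nearby, by continuity of a determinant, and can be
    corrected there. *)
Lemma patch_directions x0 : U x0 -> injective ('d phi x0) -> (0 < d)%N -> (d <= p.+1)%N ->
  exists j : 'I_d, \forall y \near x0, U y /\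
    forall i : 'I_d, i != j -> exists v : 'rV[R]_p, forall k : 'I_d, k != j -> ('D_v phi y) 0 k = (k == i)%:R.
Proof.
move=> Ux inj d0 dp; pose J := jacobian phi x0.
have JE v : v *m J = 'D_v phi x0 by rewrite (deriveEjacobian _ (phi_diff _ Ux)).
have fJ : row_free J.
  apply: inj_row_free => v; rewrite JE (deriveE _ (phi_diff _ Ux)) => h.
  by apply: inj; rewrite h linear0.
have [j /row_fullP [B BJ]] := row_free_drop_column _ _ _ J d0 dp fJ.
exists j; pose v (i : 'I_d) : 'rV[R]_p := if i == j then 0 else row i (lsubmx B).
(* Replacing column [j] by that of the identity, together with the default [v j = 0], gives
   [M x0 = 1]. *)
pose M y : 'M[R]_d := \matrix_(i, k) if k == j then (i == j)%:R else ('D_(v i) phi y) 0 k.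
have M1 : M x0 = 1%:M.
  apply/matrixP => i k; rewrite !mxE; case: (eqVneq k j) => [->//|kj].
  rewrite -JE /v; case: (eqVneq i j) => [->|ij].
    by rewrite mul0mx mxE eq_sym (negbTE kj).
  have /matrixP/(_ i k) := BJ; rewrite -[B]hsubmxK mul_row_col !mxE => <-.
  rewrite [X in _ = _ + X]big_ord1 !mxE eqxx /= (negbTE kj) mulr0 addr0 row_mxKl.
  by apply: eq_bigr => l _; rewrite mxE.
have cM : (fun y => \det (M y)) @ x0 --> \det (M x0).
  apply: continuous_at_det => a b.
  case: (eqVneq b j) => [->|bj].
    by apply: (@continuous_at_cst _ _ x0 (fun y => M y a j) (a == j)%:R) => y; rewrite mxE eqxx.
  apply: (@continuous_at_coord _ _ x0 _ (fun y => M y a b) (fun y => 'D_(v a) phi y) b (phi_C1 (v a) x0 Ux)).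
  by move=> y; rewrite mxE (negbTE bj).
have nM : \forall y \near x0, \det (M y) != 0.
  by apply: continuous_at_neq0 => //; rewrite M1 det1 oner_neq0.
have nU : \forall y \near x0, U y by exact: open_nbhs_nbhs.
apply: filterS2 nU nM => y Uy My; split=> // i ij.
have Mu : M y \in unitmx by rewrite unitmxE unitfE.
(* Row [i] of the inverse of [M y] gives the combination of the [v l] whose derivative is the [i]-th
   unit vector off [j]. *)
pose c := (delta_mx 0 i : 'rV[R]_d) *m invmx (M y).
exists (\sum_l c 0 l *: v l) => k kj.
have cM' : c *m M y = delta_mx 0 i by rewrite /c mulmxKV.
have E : \sum_l c 0 l * M y l k = (k == i)%:R.
  by have /rowP/(_ k) := cM'; rewrite mxE => ->; rewrite mxE eqxx.
have Mlk l : M y l k = ('D_(v l) phi y) 0 k by rewrite mxE (negbTE kj).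
rewrite -E (deriveE _ (phi_diff _ Uy)) linear_sum summxE; apply: eq_bigr => l _.
by rewrite Mlk linearZ mxE (deriveE _ (phi_diff _ Uy)).
Qed.

Lemma derive_line (x v : 'rV[R]_p) (k : 'I_d) (c : R) : U x ->
  is_derive (0 : R) 1 (fun h => phi (h *: v + x) 0 k / c) (('D_v phi x) 0 k / c).
Proof.
move=> Ux; have dv : derivable phi x v by exact/diff_derivable/phi_diff.
have dk : derivable (fun y => phi y 0 k) x v by exact: ((derivable_mxP phi x v).1 dv 0 k).
have d1 := (derivable1P _ _ _).1 dk.
have E : 'D_1 (fun h : R => phi (h *: v + x) 0 k) 0 = ('D_v phi x) 0 k.
  rewrite (derive_mx dv) mxE /derive; set g1 := fun h => h^-1 *: _; set g2 := fun h => h^-1 *: _.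
  suff -> : g1 = g2 by [].
  by rewrite funeqE /g1 /g2 => h /=; rewrite addr0 scale0r add0r [_%:A]mulr1.
have := derivableP d1; rewrite E => Hd.
have := is_deriveZ c^-1 Hd; rewrite -[_ *: _]/(_ * _) mulrC.
by congr is_derive; apply/funext => h /=; rewrite mulrC.
Qed.
End Patch.

(** * The dimension bound *)

Theorem mainTheorem11 (R : realType) (d : nat) (q : 'I_d -> nat)
  (V : lattice d -> R) (m : nat) (lam : R) :
  (3 <= d)%N ->
  (forall j, (0 < q j)%N) ->
  \big[gcdn/0%N]_(j < d) q j = 1%N ->
  Gamma_periodic q V ->
  (1 <= m <= \prod_(j < d) q j)%N ->
  (exists2 k0, unit_box R d k0 & band q V m k0 = lam) ->
  ((forall k, unit_box R d k -> band q V m k <= lam) \/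
   (forall k, unit_box R d k -> lam <= band q V m k)) ->
  dim_le (d - 2) [set k | unit_box R d k /\ band q V m k = lam].
Proof.
move=> d3 q0 qgcd _ mN _ Hext p pd [U [phi [Uo [x0 Ux0] Usub Udiff UC1]]].
have bandE k : exists2 k', unit_box R d k' & band q V m k' = band q V m k.
  by have [k' bk' E] := Dmat_frac R d q V k; exists k'; [exact: bk'|rewrite /band /eigen_spec E].
(* A sign condition common to maxima and minima, valid for all real quasimomenta. *)
have ext k1 k2 : 0 <= (band q V m k1 - lam) * (band q V m k2 - lam).
  have [k1' b1 <-] := bandE k1; have [k2' b2 <-] := bandE k2.
  case: Hext => H; first by rewrite mulr_le0 // subr_le0 H.
  by rewrite mulr_ge0 // subr_ge0 H.
have diff x : U x -> differentiable phi x by move=> /Udiff [].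
have d0 : (0 < d)%N by exact: leq_trans d3.
have dp : (d <= p.+1)%N by lia.
have [_ inj0] := Udiff _ Ux0.
have [j nearj] := patch_directions _ _ _ _ _ Uo diff UC1 _ Ux0 inj0 d0 dp.
pose N := #|cell q|.
have N0 : (0 < N.*2)%N.
  by rewrite double_gt0 /N card_cell; case/andP: mN => m1 mN; apply: leq_trans m1 mN.
pose v : 'rV[R[i]]_N := potential d q R V - const_mx ((lam%:C)%C).
pose f (w : 'I_d -> R[i]) := \det (sylv _ N.*2 (fibre_poly _ d q j v w)).
have fL : laurent _ d j f by apply: laurent_det_sylv; exact: laurent_fibre_poly.
have dj : exists i0 : 'I_d, i0 != j.
  have d1 : (1 < d)%N by exact: leq_trans d3.
  case: (eqVneq (Ordinal d0) j) => [<-|h]; last by exists (Ordinal d0).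
  by exists (Ordinal d1).
have [w w0 sep] := generic_separable _ d q j q0 qgcd dj v.
suff f0 : f w = 0.
  have := det_sylv_separable _ N.*2 _ (size_fibre_poly _ d q j v w) sep.
  by rewrite -/(f w) f0 eqxx.
pose W := [set y | U y /\ forall i : 'I_d, i != j -> exists v : 'rV[R]_p,
   forall k : 'I_d, k != j -> ('D_v phi y) 0 k = (k == i)%:R].
(* Dividing by [q_i] makes [e (x i)] the multiplier [w_i]. The interior of [W] leaves room to follow
   a curve through each point. *)
pose P (x : 'I_d -> R) := exists2 y, W° y & x = fun i => phi y 0 i / (q i)%:R.
apply: (laurent_vanish R d j f P fL) w0.
- by exists (fun i => phi x0 0 i / (q i)%:R), x0 => //; exact: nbhs_singleton (nbhs_interior nearj).
- move=> _ [y Wy ->] i ij; have [Uy /(_ _ ij)[u Hu]] := interior_subset Wy.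
  (* The velocity [q_i u] compensates the division by [q_i], so coordinate [i] has derivative 1 and
     the others, apart from [j], have derivative 0. *)
  exists (fun h k => phi (h *: ((q i)%:R *: u) + y) 0 k / (q k)%:R); split.
  + by apply/funext => k; rewrite scale0r add0r.
  + move=> k kj; apply: is_derive_eq (derive_line _ _ _ _ _ diff _ _ _ _ Uy) _.
    rewrite (deriveE _ (diff _ Uy)) linearZ -(deriveE _ (diff _ Uy)) mxE Hu //.
    case: eqP => [->|_]; last by rewrite mulr0 mul0r.
    by rewrite mulr1 divff // pnatr_eq0 -lt0n.
  + have cl : {for (0 : R), continuous (fun h : R => h *: ((q i)%:R *: u) + y)}.
      by apply: continuousD; [exact: scalel_continuous|exact: cst_continuous].
    have nb : nbhs ((0 : R) *: ((q i)%:R *: u) + y) W°.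
      by rewrite scale0r add0r; apply: open_nbhs_nbhs; split=> //; exact: open_interior.
    have nb' : \forall h \near (0 : R), W° (h *: ((q i)%:R *: u) + y) by exact: cl _ nb.
    by apply: filterS nb' => h Wh; exists (h *: ((q i)%:R *: u) + y).
(* Points of the patch lie in the level set, where the fibre polynomial has a double root, so [f]
   vanishes. *)
- move=> _ [y Wy ->]; have [Uy _] := interior_subset Wy.
  have [_ bk] : unit_box R d (phi y) /\ band q V m (phi y) = lam by apply: Usub; exists y.
  have mN' : (1 <= m <= #|cell q|)%N by rewrite card_cell.
  have [r1 r2] := fibre_double_root R d q V q0 m lam (phi y) j mN' bk ext.
  apply: (det_sylv_double_root _ _ _ _ N0 _ r1 r2).
  by rewrite size_fibre_poly.
Qed.
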